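(* Assume that $\frac{\nu P'(\bar\rho)}{\gamma\bar\rho}<\beta$. Then there exists a positive constant $\Theta$ such that for every $\bar\Theta\in\left(0,\frac{\Theta}{2}\right]$ the linear system $$\begin{cases}\rho_t+\bar\rho\,\mathrm{div}\,\mathbf u=0,\\ \mathbf u_t+\frac{P'(\bar\rho)}{\bar\rho}\nabla\rho+\alpha\mathbf u-\beta\nabla\phi=0,\\ \phi_t=\mu\Delta\phi-\nu\phi+\gamma\rho\end{cases}$$ on $\mathbb R^3\times(0,\infty)$ admits an (unstable) solution $(\rho^l_{\bar\Theta},\mathbf u^l_{\bar\Theta},\phi^l_{\bar\Theta})$ with initial data $(\rho^l_{0,\bar\Theta},\mathbf u^l_{0,\bar\Theta},\phi^l_{0,\bar\Theta})$ satisfying $$\left(\rho^l_{\bar\Theta}-\bar\rho,\ \mathbf u^l_{\bar\Theta},\ \phi^l_{\bar\Theta}-\tfrac{\gamma}{\nu}\bar\rho\right)\in C^0(0,\infty;H^3(\mathbb R^3))$$ and, for all $t\ge 0$, $$\begin{cases} e^{(\Theta-\bar\Theta)t}\|\rho^l_{0,\bar\Theta}-\bar\rho\|_{L^2}\le\|\rho^l_{\bar\Theta}(t)-\bar\rho\|_{L^2}\le e^{\Theta t}\|\rho^l_{0,\bar\Theta}-\bar\rho\|_{L^2},\\ e^{(\Theta-\bar\Theta)t}\|\mathbf u^l_{0,\bar\Theta}\|_{L^2}\le\|\mathbf u^l_{\bar\Theta}(t)\|_{L^2}\le e^{\Theta t}\|\mathbf u^l_{0,\bar\Theta}\|_{L^2},\\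 e^{(\Theta-\bar\Theta)t}\|\phi^l_{0,\bar\Theta}-\frac{\gamma}{\nu}\bar\rho\|_{L^2}\le\|\phi^l_{\bar\Theta}(t)-\frac{\gamma}{\nu}\bar\rho\|_{L^2}\le e^{\Theta t}\|\phi^l_{0,\bar\Theta}-\frac{\gamma}{\nu}\bar\rho\|_{L^2}.\end{cases}$$ Moreover, the initial data (which depend on $\bar\Theta$) satisfy $$\|\rho^l_{0,\bar\Theta}-\bar\rho\|_{L^2}\,\|\mathbf u^l_{0,\bar\Theta}\|_{L^2}\,\left\|\phi^l_{0,\bar\Theta}-\tfrac{\gamma}{\nu}\bar\rho\right\|_{L^2}>0.$$
   Context: The constants $\alpha,\beta,\mu,\nu,\gamma$ and $\bar\rho$ are positive. The pressure $P=P(\rho)$ is a smooth function with $P'(\rho)>0$ for $\rho>0$. The unknowns are $\rho,\phi$ (scalar functions) and $\mathbf u=(u_1,u_2,u_3)^T$ (a vector field) of $(x,t)\in\mathbb R^3\times\mathbb R^+$. The constant state $(\bar\rho,0,\frac{\gamma}{\nu}\bar\rho)$ is a steady solution of the linear system. $L^2=L^2(\mathbb R^3)$ and $H^3(\mathbb R^3)$ is the usual Sobolev space. *)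

(* Defs.v *)
From HB Require Import structures.
From mathcomp Require Import all_boot all_order all_algebra.
From mathcomp Require Import all_classical all_reals all_analysis.

Set Implicit Arguments.
Unset Strict Implicit.
Unset Printing Implicit Defensive.

Import Order.TTheory GRing.Theory Num.Theory.
Import numFieldNormedType.Exports.

Local Open Scope classical_set_scope.
Local Open Scope ring_scope.

Notation R3 R := (R * R * R)%type.

(* R3 R with the Borel sigma-algebra carried by the domain of lebesgue_measure;
   convertible to R3 R, which carries the normed-module structure. *)
Notation mR3 R :=
  (measurableTypeR R * measurableTypeR R * measurableTypeR R)%type.

Definition lebesgue3 (R : realType) : {measure set (mR3 R) -> \bar R} :=
  [the measure _ _ of
    ((@lebesgue_measure R \x @lebesgue_measure R) \x @lebesgue_measure R)%E].

Definition basis3 (R : realType) (i : 'I_3) : R3 R :=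
  ((i == 0 :> nat)%:R, (i == 1 :> nat)%:R, (i == 2 :> nat)%:R).

Definition partial (R : realType) (i : 'I_3) (f : R3 R -> R) : R3 R -> R :=
  fun x => 'D_(basis3 R i) f x.

Definition has_partial (R : realType) (i : 'I_3) (f : R3 R -> R) (x : R3 R)
  : Prop := derivable f x (basis3 R i).

Definition laplacian (R : realType) (f : R3 R -> R) : R3 R -> R :=
  fun x => \sum_(i < 3) partial i (partial i f) x.

Definition vcomp (R : realType) (v : R3 R -> 'rV[R]_3) (i : 'I_3) : R3 R -> R :=
  fun x => v x ord0 i.

Definition divergence (R : realType) (v : R3 R -> 'rV[R]_3) : R3 R -> R :=
  fun x => \sum_(i < 3) partial i (vcomp v i) x.

Definition gradient (R : realType) (f : R3 R -> R) : R3 R -> 'rV[R]_3 :=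
  fun x => \row_(i < 3) partial i f x.

Section Lebesgue_Sobolev.
Context {R : realType}.
Implicit Types (f g : R3 R -> R) (v : R3 R -> 'rV[R]_3).

Definition in_L2 f : Prop := f \in Lfun (lebesgue3 R) 2%:E.

Definition L2norm f : \bar R := 'N[lebesgue3 R]_2%:E[EFin \o f]%E.

(* The library norm on row vectors is the max norm. *)
Definition euclid (w : 'rV[R]_3) : R := Num.sqrt (\sum_(i < 3) w ord0 i ^+ 2).

Definition L2normv v : \bar R := L2norm (euclid \o v).

Definition smooth3 f : Prop :=
  forall s : seq 'I_3, continuous (foldr (@partial R) f s) /\
    forall i x, has_partial i (foldr (@partial R) f s) x.

Definition test_function f : Prop :=
  smooth3 f /\ compact (closure [set x | f x != 0]).

Definition order_mi k (a : {ffun 'I_3 -> 'I_k.+1}) : nat := (\sum_(i < 3) a i)%N.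

Definition partial_mi k (a : {ffun 'I_3 -> 'I_k.+1}) f : R3 R -> R :=
  foldr (fun i => iter (a i) (partial i)) f (enum 'I_3).

Definition weak_partial k (a : {ffun 'I_3 -> 'I_k.+1}) f g : Prop :=
  forall psi, test_function psi ->
    \int[lebesgue3 R]_x (f x * partial_mi a psi x) =
    (-1) ^+ order_mi a * \int[lebesgue3 R]_x (g x * psi x).

(* a family, indexed by the multi-indices of order at most k, of L^2 weak
   derivatives of f; other indices are unconstrained *)
Definition weak_jet (k : nat) f (G : {ffun 'I_3 -> 'I_k.+1} -> R3 R -> R)
  : Prop :=
  forall a : {ffun 'I_3 -> 'I_k.+1}, (order_mi a <= k)%N ->
    in_L2 (G a) /\ weak_partial a f (G a).

Definition in_H (k : nat) f : Prop := in_L2 f /\ exists G, @weak_jet k f G.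

(* For f in H^k the weak derivatives are unique up to null sets, so that the
   set below is the singleton of the usual norm of f (and Hnorm is +oo when f
   has no weak derivatives in L^2). *)
Definition Hnorm (k : nat) f : \bar R :=
  ereal_inf [set ((\sum_(a : {ffun 'I_3 -> 'I_k.+1} | (order_mi a <= k)%N)
                     L2norm (G a) ^+ 2) `^ 2^-1)%E | G in @weak_jet k f].

(* f is in C^0([0, oo); H^k); continuity at 0 is one-sided *)
Definition continuous_into_H (k : nat) (f : R -> R3 R -> R) : Prop :=
  (forall t, 0 <= t -> in_H k (f t)) /\
  forall t, 0 <= t ->
    Hnorm k (f s \- f t) @[s --> within `[0, +oo[ (nbhs t)] --> 0%E.

End Lebesgue_Sobolev.

(* Classical solutions on R^3 x (0, oo): 'D and derive1 are total, so the
   existence of every derivative entering the system is required explicitly. *)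
Definition linear_system (R : realType) (alpha beta mu nu gamma rhobar : R)
    (P : R -> R) (rho : R -> R3 R -> R) (u : R -> R3 R -> 'rV[R]_3)
    (phi : R -> R3 R -> R) : Prop :=
  forall (t : R) (x : R3 R), 0 < t ->
  [/\ [/\ derivable (rho ^~ x) t 1,
          forall i : 'I_3, derivable (fun s => u s x ord0 i) t 1 &
          derivable (phi ^~ x) t 1],
      (forall i : 'I_3,
        [/\ has_partial i (rho t) x,
            forall j : 'I_3, has_partial i (vcomp (u t) j) x,
            has_partial i (phi t) x &
            has_partial i (partial i (phi t)) x]),
      derive1 (rho ^~ x) t + rhobar * divergence (u t) x = 0,
      (\row_(i < 3) derive1 (fun s => u s x ord0 i) t)
        + (derive1 P rhobar / rhobar) *: gradient (rho t) x
        + alpha *: u t x - beta *: gradient (phi t) x = 0 &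
      derive1 (phi ^~ x) t
        = mu * laplacian (phi t) x - nu * phi t x + gamma * rho t x].

(* Main.v *)
(**
  A plane wave of frequency [xi] solves the linear system with growth rate [l]
  exactly when [l] is a root of a cubic whose coefficients depend only on
  [k = |xi|^2].  Under the instability condition the cubic has exactly one
  nonnegative root on [0 <= k <= kstar]; it depends continuously on [k], it
  vanishes at both ends of this interval and it is positive inside.  [Theta]
  is the maximum of this root, attained at some [k0 > 0].

  Given [Thetabar], the solution is a superposition of growing waves over a
  small cube of frequencies on which the rate lies in
  [[Theta - Thetabar, Theta]].  To stay with real functions the plane waves are
  replaced by products of one-dimensional cosines, on which the Laplacian acts
  in the same way, and the cube is kept away from the coordinate planes.  By
  Plancherel, the squared norm of each component is a constant times the
  integral over the cube of the squared amplitude times [exp (2 t rate)], which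
  gives the two-sided exponential bounds and the continuity in [H^3].

  Plancherel is proved in one variable by inserting the weight
  [exp (- e |x|)], which turns the double integral over frequencies into an
  integral against a Poisson kernel, and letting [e] tend to 0; Tonelli's
  theorem then gives the three-dimensional case one variable at a time.
*)
Require Import Defs.
From HB Require Import structures.
From mathcomp Require Import all_boot all_order all_algebra.
From mathcomp Require Import all_classical all_reals all_analysis.
From mathcomp Require Import measurable_realfun.
From mathcomp Require Import ring lra.

Set Implicit Arguments.
Unset Strict Implicit.
Unset Printing Implicit Defensive.

Import Order.TTheory GRing.Theory Num.Theory.
Import numFieldNormedType.Exports.

Local Open Scope classical_set_scope.
Local Open Scope ring_scope.

(** * Measurability and integrals depending on a parameter *)

(** Only one root of the cubic is ever used. Each component therefore has an energy with nonnegative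
    weights [exp (2 t rate)], and the bounds hold with constant exactly 1, component by component.
    The eigenvector is scaled to be polynomial in the rate and the frequency: the amplitudes are
    continuous, and positive on the cube, so no component vanishes. The velocity is a gradient, so
    its components are waves with a quarter-period phase shift, and Plancherel must hold for every
    such phase. A product of two phased cosines yields, besides the kernel in s - t, a reflected
    kernel in s + t; for frequencies at least a > 0 the latter tends to 0, which is why the cube
    avoids the coordinate planes. A synthesis is known beforehand only to be bounded, so its square
    is integrated in the extended reals, and finiteness is part of the result. The cube lies in k1
    <= |xi|^2 <= k0, on one side of the maximiser k0, where the cubic relation is available and the
    rate is within Thetabar of its maximum. *)

Section Caratheodory.
Context {R : realType} d (X : measurableType d).

(** Source of the joint measurability that Tonelli and Fubini ask for: transforms and syntheses are
    parametric integrals, for which continuity in each variable separately is easy to establish. *)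
Lemma caratheodory_measurable (f : X -> R -> R) :
  (forall y, measurable_fun setT (f ^~ y)) ->
  (forall x, continuous (f x)) ->
  measurable_fun [set: X * measurableTypeR R] (fun z => f z.1 z.2).
Proof.
move=> mf cf.
(* [f x y] is the limit of [f x (q n y)], where [q n] takes countably many values. *)
pose q (n : nat) (y : R) : R := (Num.floor (y * n.+1%:R))%:~R / n.+1%:R.
have qcvg (y : R) : q n y @[n --> \oo] --> y.
  apply/cvgrPdist_lt => e e0; near=> n.
  have n0 : 0 < n.+1%:R :> R by rewrite ltr0n.
  have -> : y - q n y = (y * n.+1%:R - (Num.floor (y * n.+1%:R))%:~R) / n.+1%:R.
    by rewrite mulrBl mulfK ?gt_eqF.
  rewrite ger0_norm; last by rewrite divr_ge0 ?subr_ge0 ?floor_le// ltW.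
  apply: (@le_lt_trans _ _ (n.+1%:R^-1)).
    rewrite ler_pdivrMr// mulVf ?gt_eqF// lerBlDl.
    by have := floorD1_gt (y * n.+1%:R); rewrite intrD => /ltW.
  by near: n; exact: near_infty_natSinv_lt (PosNum e0).
apply/measurable_EFinP.
apply: (@emeasurable_fun_cvg _ _ _ [set: X * measurableTypeR R]
  (fun n z => (f z.1 (q n z.2))%:E)); last first.
  move=> z _; apply: cvg_EFin; first exact: nearW.
  by apply: (@cvg_comp _ _ _ (q ^~ z.2) (f z.1)); [exact: qcvg|exact: cf].
move=> n; apply/measurable_EFinP => _ B mB; rewrite setTI.
(* On the strip where the floor equals [k] the approximation does not depend on [y], so the preimage
   is a countable union of rectangles. *)
rewrite (_ : _ @^-1` _ = \bigcup_(k : int)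
     ([set x | B (f x (k%:~R / n.+1%:R))] `*`
      [set y : measurableTypeR R | Num.floor (y * n.+1%:R) = k])); last first.
  apply/seteqP; split => [[x y] /= Bxy|[x y] [k _ [/= Bx yk]]]; last by rewrite /q yk.
  by exists (Num.floor (y * n.+1%:R)).
apply: countable_bigcupT_measurable; first exact: countableP.
move=> k; apply: measurableX.
  by rewrite -[X in measurable X]setTI; exact: mf.
rewrite (_ : [set _ | _] = `[k%:~R / n.+1%:R, (k + 1)%:~R / n.+1%:R[%classic).
  exact: measurable_itv.
apply/seteqP; split => [y /= <-|y /=]; rewrite in_itv/= ?ler_pdivrMr ?ltr_pdivlMr ?ltr0n//.
  by rewrite floor_le floorD1_gt.
by move=> /floor_def.
Unshelve. all: by end_near. Qed.

End Caratheodory.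

Section bounded_integrals.
Context {R : realType} d (Y : measurableType d) (mu : {measure set Y -> \bar R}).
Variables (D : set Y) (mD : measurable D) (finD : (mu D < +oo)%E).

Lemma integrable_le_cst (f : Y -> R) (M : R) : measurable_fun D f ->
  (forall y, D y -> `|f y| <= M) -> mu.-integrable D (EFin \o f).
Proof.
move=> mf fM; apply: measurable_bounded_integrable => //.
by exists M; split; [exact: num_real|move=> x /= Mx y Dy; rewrite (le_trans (fM _ Dy))// ltW].
Qed.

Lemma normr_Rintegral_le (f : Y -> R) (M : R) : measurable_fun D f ->
  (forall y, D y -> `|f y| <= M) ->
  `|\int[mu]_(y in D) f y| <= M * fine (mu D).
Proof.
move=> mf fM; have fi := integrable_le_cst mf fM.
apply: (le_trans (le_normr_Rintegral mD fi)).
rewrite -Rintegral_cst//; apply: le_Rintegral => //.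
  by apply: (@integrable_le_cst _ M) => //;
    [exact: measurableT_comp|move=> y Dy; rewrite normr_id fM].
by apply: (@integrable_le_cst _ `|M|) => //.
Qed.

Lemma continuous_Rintegral_le_cst (f : R -> Y -> R) (M : R) :
  (forall p, measurable_fun D (f p)) ->
  (forall y, D y -> continuous (f ^~ y)) ->
  (forall p y, D y -> `|f p y| <= M) ->
  continuous (fun p => \int[mu]_(y in D) f p y).
Proof.
move=> mf cf fM p.
apply: (@continuity_under_integral _ _ _ mu f D mD (p - 1) (p + 1) _ _ (cst M)) => //.
- by move=> q _; exact: integrable_le_cst (mf q) (fM q).
- by apply: aeW => y Dy q _; exact: cf.
- by apply: (@integrable_le_cst _ `|M|) => // y _.
- by move=> q _; apply: aeW => y; exact: fM.
- by rewrite inE/= in_itv/=; apply/andP; split; lra.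
Qed.

(** The bounds are local in the parameter because the time factor [expR (t * l)] has no bound
    uniform in [t]. *)
Lemma is_derive_Rintegral_le_cst (f f' : R -> Y -> R) (M M' : R) (p : R) :
  (forall p, measurable_fun D (f p)) ->
  (forall q y, D y -> `|q - p| < 1 -> `|f q y| <= M) ->
  (forall (q : R) y, D y -> is_derive q (1 : R) (f ^~ y) (f' q y)) ->
  (forall q y, D y -> `|q - p| < 1 -> `|f' q y| <= M') ->
  is_derive p (1 : R) (fun p => \int[mu]_(y in D) f p y) (\int[mu]_(y in D) f' p y).
Proof.
move=> mf fM df f'M.
have pI : `]p - 1, p + 1[%classic p by rewrite /= in_itv/=; apply/andP; split; lra.
have dist q : `]p - 1, p + 1[%classic q -> `|q - p| < 1.
  by rewrite /= in_itv/= => /andP[? ?]; rewrite ltr_distl; apply/andP.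
have i1 q : `]p - 1, p + 1[%classic q -> mu.-integrable D (EFin \o f q).
  by move=> /dist qp; apply: (@integrable_le_cst _ M) => // y Dy; exact: fM.
have i2 q y : `]p - 1, p + 1[%classic q -> D y -> derivable (f ^~ y) q 1.
  by move=> _ Dy; have [] := df q y Dy.
have i3 : mu.-integrable D (EFin \o cst `|M'|).
  by apply: (@integrable_le_cst _ `|M'|) => // y _; rewrite /= normr_id.
have i4 q y : `]p - 1, p + 1[%classic q -> D y -> `|derive1 (f ^~ y) q| <= cst `|M'| y.
  move=> /dist qp Dy; rewrite derive1E; have [_ ->] := df q y Dy.
  by rewrite (le_trans (f'M _ _ Dy qp))// ler_norm.
apply: DeriveDef.
  exact: (@derivable_under_integral _ _ _ mu f D mD p _ _ pI i1 i2 (cst `|M'|)).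
rewrite -derive1E.
rewrite (@differentiation_under_integral _ _ _ mu f D mD p _ _ pI i1 i2 (cst `|M'|))//.
apply: eq_Rintegral => y; rewrite inE => Dy.
by rewrite partial1of2E; have [_ ->] := df p y Dy.
Qed.

End bounded_integrals.

Section parametric.
Context {R : realType} d (X : measurableType d).
Notation mu := (@lebesgue_measure R).

(** The real integral is [fine] of the difference of the integrals of the positive and negative
    parts; Tonelli makes each of these measurable in the parameter. *)
Lemma measurable_fun_Rintegral_param (f : X -> R -> R) (D : set R) :
  measurable D ->
  measurable_fun [set: X * measurableTypeR R] (fun z => f z.1 z.2) ->
  measurable_fun setT (fun x => \int[mu]_(s in D) f x s).
Proof.
move=> mD mf.
pose h (z : X * measurableTypeR R) : \bar R := (f z.1 z.2 * \1_D z.2)%:E.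
have mh : measurable_fun setT h.
  apply/measurable_EFinP; apply: measurable_funM => //.
  apply: (measurableT_comp (f := fun y : measurableTypeR R => \1_D y : R)) => //; exact: measurable_indic.
rewrite [X0 in measurable_fun _ X0](_ : _ =
  fun x => fine (\int[mu]_s (h^\+)%E (x, s) - \int[mu]_s (h^\-)%E (x, s))%E).
  apply: measurableT_comp; first exact: fine_measurable.
  apply: emeasurable_funB.
    apply: (@measurable_fun_fubini_tonelli_F _ _ _ _ _ mu (h^\+)%E) => //.
    exact: measurable_funepos.
  - apply: (@measurable_fun_fubini_tonelli_F _ _ _ _ _ mu (h^\-)%E) => //.
    exact: measurable_funeneg.
apply/funext => x; rewrite /Rintegral; congr fine.
rewrite integral_mkcond integralE; congr (_ - _)%E; apply: eq_integral => s _.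
- rewrite !funeposE /h patchE/=; congr maxe.
  by rewrite indicE; case: (s \in D); rewrite ?mulr1 ?mulr0.
- rewrite !funenegE /h patchE/=.
  by rewrite indicE; case: (s \in D); rewrite ?mulr1 ?mulr0.
Qed.
End parametric.

Lemma lebesgue_measure_itv_lty (R : realType) (a b : R) : a < b ->
  (@lebesgue_measure R `[a, b] < +oo)%E.
Proof. by move=> ab; rewrite /= lebesgue_measure_itv/= lte_fin ab -EFinB ltry. Qed.

(** * Cosines with quarter-period phases *)

Section phase.
Context {R : realType}.
(* The [m]-th derivative of [cos]. *)
Definition tau (m : nat) (y : R) : R := cos (y + m%:R * (pi / 2)).

Lemma tau_le1 m y : `|tau m y| <= 1. Proof. exact: cos_max. Qed.

Lemma tauS m y : tau m.+1 y = - sin (y + m%:R * (pi / 2)).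
Proof. by rewrite /tau -natr1 mulrDl mul1r addrA cosDpihalf. Qed.

Lemma tauSS m y : tau m.+2 y = - tau m y.
Proof. by rewrite tauS -natr1 mulrDl mul1r addrA sinDpihalf. Qed.

(** Both factors carry the phase [m * pi / 2]: it cancels in the difference and adds up to [m * pi]
    in the sum, hence the sign. *)
Lemma tau_mul m (y z : R) :
  tau m y * tau m z = 2^-1 * (cos (y - z) + (-1) ^+ m * cos (y + z)).
Proof.
have H (u v : R) : cos u * cos v = 2^-1 * (cos (u - v) + cos (u + v)).
  by rewrite cosB cosD; field.
rewrite /tau H; congr (_ * (cos _ + _)); first by ring.
rewrite (_ : y + _ + _ = y + z + m%:R * pi); last by field.
elim: m => [|m IH]; first by rewrite mul0r addr0 expr0 mul1r.
by rewrite -natr1 mulrDl mul1r addrA cosDpi IH exprS mulN1r mulNr.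
Qed.

Lemma is_derive_tau m (s x : R) :
  is_derive x (1 : R) (fun x => tau m (s * x)) (s * tau m.+1 (s * x)).
Proof.
rewrite tauS /tau.
apply: is_derive_eq.
by rewrite /GRing.scale/= ; ring.
Qed.

Lemma continuous_tau m : continuous (tau m).
Proof.
move=> y; apply: continuous_comp; last exact: continuous_cos.
by apply: continuousD; [exact: cvg_id|exact: cvg_cst].
Qed.

End phase.

(** * The Plancherel identity for trigonometric transforms *)

Section exponential_weight.
Context {R : realType}.
Notation mu := (@lebesgue_measure R).
Variables (e : R) (e0 : 0 < e).

Definition expw (e x : R) : R := expR (- (e * `|x|)).

Lemma expw_ge0 x : 0 <= expw e x. Proof. exact: expR_ge0. Qed.

Lemma continuous_expw : continuous (expw e).
Proof.
move=> x; apply: continuous_comp; last exact: continuous_expR.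
by apply/continuousN/continuousM; [exact: cvg_cst|exact: norm_continuous].
Qed.

Lemma measurable_expw : measurable_fun setT (expw e).
Proof. exact: continuous_measurable_fun continuous_expw. Qed.

(** Adding 1 to the cosine makes the integrand nonnegative, as the reduction to the half line and
    the fundamental theorem of calculus there require. The integral of the weight alone is
    subtracted afterwards. *)
Lemma integral_expw_1cos (u : R) :
  (\int[mu]_x (expw e x * (1 + cos (u * x)))%:E =
   (2 / e + 2 * (e / (e ^+ 2 + u ^+ 2)))%:E)%E.
Proof.
have D0 : 0 < e ^+ 2 + u ^+ 2 by rewrite ltr_wpDr ?sqr_ge0// exprn_gt0.
pose f (x : R) : R := expR (- (e * x)) * (1 + cos (u * x)).
(* An antiderivative of [f] that tends to 0 at infinity, so that the integral over the half line is
   [- F 0]. *)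
pose F (x : R) : R := expR (- (e * x)) *
  ((u * sin (u * x) - e * cos (u * x)) / (e ^+ 2 + u ^+ 2) - e^-1).
have cf : continuous f.
  move=> x; rewrite /f; apply: cvgM.
    apply: continuous_comp; last exact: continuous_expR.
    by apply/continuousN/continuousM; [exact: cvg_cst|exact: cvg_id].
  apply: continuousD; first exact: cvg_cst.
  apply: continuous_comp; last exact: continuous_cos.
  by apply: continuousM; [exact: cvg_cst|exact: cvg_id].
have dF (x : R) : is_derive x (1 : R) F (f x).
  apply: is_derive_eq.
  rewrite /GRing.scale/= /f; field.
  by rewrite !gt_eqF.
rewrite ge0_symfun_integralT; last 3 first.
- by move=> x; rewrite mulr_ge0 ?expw_ge0// -lerBlDl sub0r cos_geN1.
- move=> x; apply: continuousM; first exact: continuous_expw.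
  apply: continuousD; first exact: cvg_cst.
  apply: continuous_comp; last exact: continuous_cos.
  by apply: continuousM; [exact: cvg_cst|exact: cvg_id].
- by move=> x; rewrite /= /expw normrN mulrN cosN.
rewrite -set_itvcy.
transitivity (2%:E * \int[mu]_(x in `[0%R, +oo[) (f x)%:E)%E.
  congr (_ * _)%E; apply: eq_integral => x.
  by rewrite inE/= in_itv/= andbT => x0; rewrite /expw ger0_norm.
rewrite (@ge0_continuous_FTC2y _ f F 0 0).
- rewrite sub0e /F !mulr0 oppr0 expR0 mul1r sin0 cos0 mulr0 sub0r mulr1.
  by rewrite -EFinN -EFinM; congr EFin; field; rewrite !gt_eqF.
- by move=> x _; rewrite mulr_ge0 ?expR_ge0// -lerBlDl sub0r cos_geN1.
- exact: continuous_subspaceT.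
- pose C := (`|u| + e) / (e ^+ 2 + u ^+ 2) + e^-1.
  have cvg0 : expR (- (e * x)) * C @[x --> +oo] --> 0.
    rewrite -(mul0r C); apply: cvgM; last exact: cvg_cst.
    apply: (cvg_comp (fun x => e * x) (fun x => expR (- x))); last exact: cvgr_expR.
    exact: gt0_cvgMry.
  have C0 x : `|F x| <= expR (- (e * x)) * C.
    rewrite normrM ger0_norm ?expR_ge0// ler_wpM2l ?expR_ge0//.
    rewrite (le_trans (ler_normB _ _))// lerD//; last by rewrite ger0_norm// invr_ge0 ltW.
    rewrite normf_div (gtr0_norm D0) ler_pM2r ?invr_gt0//.
    rewrite (le_trans (ler_normB _ _))// !normrM lerD ?ler_piMr ?sin_max//.
    by rewrite (gtr0_norm e0) ler_piMr ?cos_max// ltW.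
  apply: norm_cvg0; apply: (squeeze_cvgr _ (cvg_cst 0) cvg0).
  by apply: nearW => x; rewrite normr_ge0 C0.
- by move=> x _; have [] := dF x.
- apply: cvg_at_right_filter.
  by apply: differentiable_continuous; apply/derivable1_diffP; have [] := dF 0.
- by move=> x _; rewrite derive1E; have [_ ->] := dF x.
Qed.

(** At [u = 0] the integrand of [integral_expw_1cos] is twice the weight. *)
Lemma integral_expw : (\int[mu]_x (expw e x)%:E = (2 / e)%:E)%E.
Proof.
have := integral_expw_1cos 0.
under eq_integral do rewrite mul0r cos0 mulrC EFinM.
rewrite ge0_integralZl_EFin//; last 2 first.
- by move=> x _; rewrite lee_fin expw_ge0.
- by apply/measurable_EFinP; exact: measurable_expw.
rewrite (_ : 2 / e + _ = (1 + 1) * (2 / e)); last by field; rewrite gt_eqF.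
rewrite EFinM => /(congr1 (fun z => ((1 + 1)^-1)%:E * z)%E); cbv beta.
by rewrite !muleA -!EFinM mulVf// !mul1e mul1r.
Qed.

Lemma integrable_expw : mu.-integrable setT (EFin \o expw e).
Proof.
apply/integrableP; split.
  by apply/measurable_EFinP; exact: measurable_expw.
under eq_integral do rewrite /= ger0_norm ?expw_ge0//.
by rewrite integral_expw ltry.
Qed.

Lemma integrable_expwM (h : R -> R) (M : R) : measurable_fun setT h ->
  (forall x, `|h x| <= M) ->
  mu.-integrable setT (EFin \o (fun x => expw e x * h x)).
Proof.
move=> mh hM.
apply: (@le_integrable _ _ _ mu setT measurableT _ (EFin \o (fun x => expw e x * M))).
- apply/measurable_EFinP/measurable_funM => //.
  exact: measurable_expw.
- move=> x _; rewrite /= lee_fin !normrM ler_wpM2l//.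
  by rewrite (le_trans (hM x))// ler_norm.
- rewrite /comp; under eq_fun do rewrite EFinM.
  by apply: integrableZr => //; exact: integrable_expw.
Qed.

Lemma Rintegral_expw_cos (u : R) :
  \int[mu]_x (expw e x * cos (u * x)) = 2 * (e / (e ^+ 2 + u ^+ 2)).
Proof.
have mc : measurable_fun setT (fun x => cos (u * x)).
  apply: continuous_measurable_fun => x.
  apply: continuous_comp; last exact: continuous_cos.
  by apply: continuousM; [exact: cvg_cst|exact: cvg_id].
have ic : mu.-integrable setT (EFin \o (fun x => expw e x * cos (u * x))).
  by apply: (@integrable_expwM _ 1) => // x; exact: cos_max.
have := integral_expw_1cos u => /(congr1 fine) /=; rewrite -/(Rintegral _ _ _).
under eq_Rintegral do rewrite mulrDr mulr1.
rewrite RintegralD//; last exact: integrable_expw.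
by rewrite {1}/Rintegral integral_expw /= => /addrI.
Qed.

End exponential_weight.

(** * Fubini's theorem for real-valued integrals *)

Section Rfubini.
Context {R : realType} d d' (X : measurableType d) (Y : measurableType d').
Variables (m1 : {sigma_finite_measure set X -> \bar R}).
Variables (m2 : {sigma_finite_measure set Y -> \bar R}).

Lemma integrable_prod_le (F : X * Y -> R) (p : X -> R) (q : Y -> R) :
  measurable_fun setT F ->
  m1.-integrable setT (EFin \o p) -> m2.-integrable setT (EFin \o q) ->
  (forall x y, `|F (x, y)| <= p x * q y) ->
  (m1 \x m2)%E.-integrable setT (EFin \o F).
Proof.
move=> mF ip iq Fpq.
have mp : measurable_fun setT p by apply/measurable_EFinP/(measurable_int m1).
have mq : measurable_fun setT q by apply/measurable_EFinP/(measurable_int m2).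
have mF' : measurable_fun setT (EFin \o F) by exact/measurable_EFinP.
apply/(integrable12ltyP m1 m2 mF').
apply: (@le_lt_trans _ _ (\int[m1]_x (`|p x|%:E * \int[m2]_y `|q y|%:E)))%E; last first.
  have /integrableP[_ lq] := iq; have /integrableP[_ lp] := ip.
  rewrite ge0_integralZr//; last 2 first.
  - by apply/measurable_EFinP; exact: measurableT_comp.
  - by apply: integral_ge0 => y _; rewrite lee_fin.
  by rewrite lte_mul_pinfty// ?integral_ge0// ge0_fin_numE// integral_ge0.
apply: ge0_le_integral => //.
- by move=> x _; exact: integral_ge0.
- apply: (@measurable_fun_fubini_tonelli_F _ _ _ _ _ m2 (fun z => `|(F z)%:E|))%E => //.
  exact: measurableT_comp.
- apply: emeasurable_funM => //; apply/measurable_EFinP; exact: measurableT_comp.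
- move=> x _; rewrite -ge0_integralZl//; last first.
    by apply/measurable_EFinP; exact: measurableT_comp.
  apply: ge0_le_integral => //.
  + by apply: (measurableT_comp (f := fun z => `|(F z)%:E|%E)) => //; exact: measurableT_comp.
  + by apply: measurable_funeM; apply/measurable_EFinP; exact: measurableT_comp.
  + by move=> y _; rewrite /= -EFinM lee_fin -normrM (le_trans (Fpq x y))// ler_norm.
Qed.

(** Both orders are compared with the product integral, since some uses exchange the order and
    others pass to the product. Domination by [p x * q y] makes every inner integral finite, so that
    [fine] loses nothing. *)
Lemma Rfubini (DX : set X) (DY : set Y) (F : X -> Y -> R) (p : X -> R) (q : Y -> R) :
  measurable DX -> measurable DY ->
  measurable_fun setT (fun z : X * Y => F z.1 z.2) ->
  m1.-integrable DX (EFin \o p) -> m2.-integrable DY (EFin \o q) ->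
  (forall x y, DX x -> DY y -> `|F x y| <= p x * q y) ->
  \int[m1]_(x in DX) \int[m2]_(y in DY) F x y =
    \int[(m1 \x m2)%E]_(z in DX `*` DY) F z.1 z.2 /\
  \int[m2]_(y in DY) \int[m1]_(x in DX) F x y =
    \int[(m1 \x m2)%E]_(z in DX `*` DY) F z.1 z.2.
Proof.
move=> mDX mDY mF ip iq Fpq.
pose G (z : X * Y) := F z.1 z.2 * \1_DX z.1 * \1_DY z.2.
have GE x y : G (x, y) = ((F x \_ DY) y) * \1_DX x.
  by rewrite /G/= patchE (indicE _ DY); case: (y \in DY); rewrite ?mulr1 ?mulr0 ?mul0r.
have GE' x y : G (x, y) = (((F ^~ y) \_ DX) x) * \1_DY y.
  by rewrite /G/= patchE (indicE _ DX); case: (x \in DX); rewrite ?mulr1 ?mulr0 ?mul0r.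
have iG : (m1 \x m2)%E.-integrable setT (EFin \o G).
  apply: (@integrable_prod_le G (p \_ DX) (q \_ DY)).
  - apply: measurable_funM; first apply: measurable_funM => //.
      by apply: (measurableT_comp (f := fun x => \1_DX x : R)) => //; exact: measurable_indic.
    by apply: (measurableT_comp (f := fun x => \1_DY x : R)) => //; exact: measurable_indic.
  - by move/integrable_mkcond: ip => /(_ mDX); rewrite restrict_EFin.
  - by move/integrable_mkcond: iq => /(_ mDY); rewrite restrict_EFin.
  - move=> x y; rewrite /G !patchE/= !indicE.
    have [/set_mem xD|] := boolP (x \in DX); last by rewrite mulr0 !mul0r normr0.
    have [/set_mem yD|] := boolP (y \in DY); last by rewrite !mulr0 normr0.
    by rewrite !mulr1 Fpq.
have -> : \int[(m1 \x m2)%E]_(z in DX `*` DY) F z.1 z.2 = \int[(m1 \x m2)%E]_z G z.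
  rewrite Rintegral_mkcond; apply: eq_Rintegral => -[x y] _.
  by rewrite patchE /G/= in_setX/= !indicE; case: (x \in DX); case: (y \in DY);
    rewrite /= ?mulr1 ?mulr0 ?mul0r.
split.
- rewrite [in RHS]/Rintegral -(integral12_prod_meas1 iG) Rintegral_mkcond.
  congr fine; apply: eq_integral => x _; rewrite patchE /fubini_F.
  rewrite (eq_integral (fun y => ((F x \_ DY) y * \1_DX x)%:E)); last first.
    by move=> y _; rewrite /= GE.
  rewrite indicE; have [/set_mem xD|xD] := boolP (x \in DX); last first.
    by rewrite integral0_eq// => y _; rewrite mulr0.
  under eq_integral do rewrite mulr1.
  rewrite Rintegral_mkcond fineK//.
  apply: integrable_fin_num => //.
  suff FD : m2.-integrable DY (EFin \o F x).
    by have := (integrable_mkcond _ mDY).1 FD; rewrite restrict_EFin.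
  apply: (@le_integrable _ _ _ m2 DY mDY _ (EFin \o (fun y => p x * q y))).
  + apply/measurable_EFinP/(measurable_funS measurableT) => //.
    exact: (measurableT_comp mF (pair1_measurable x)).
  + by move=> y yD; rewrite /= lee_fin (le_trans (Fpq _ _ xD yD))// ler_norm.
  + by rewrite /comp; under eq_fun do rewrite EFinM; exact: integrableZl.
- rewrite [in RHS]/Rintegral -(integral21_prod_meas1 iG) Rintegral_mkcond.
  congr fine; apply: eq_integral => y _; rewrite patchE /fubini_G.
  rewrite (eq_integral (fun x => (((F ^~ y) \_ DX) x * \1_DY y)%:E)); last first.
    by move=> x _; rewrite /= GE'.
  rewrite indicE; have [/set_mem yD|yD] := boolP (y \in DY); last first.
    by rewrite integral0_eq// => x _; rewrite mulr0.
  under eq_integral do rewrite mulr1.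
  rewrite Rintegral_mkcond fineK//.
  apply: integrable_fin_num => //.
  suff FD : m1.-integrable DX (EFin \o F ^~ y).
    by have := (integrable_mkcond _ mDX).1 FD; rewrite restrict_EFin.
  apply: (@le_integrable _ _ _ m1 DX mDX _ (EFin \o (fun x => p x * q y))).
  + apply/measurable_EFinP/(measurable_funS measurableT) => //.
    exact: (measurableT_comp mF (pair2_measurable y)).
  + by move=> x xD; rewrite /= lee_fin (le_trans (Fpq _ _ xD yD))// ler_norm.
  + by rewrite /comp; under eq_fun do rewrite EFinM; exact: integrableZr.
Qed.

End Rfubini.

(** * The Poisson kernel and weighted trigonometric transforms *)

Section poisson_kernel.
Context {R : realType}.
Notation mu := (@lebesgue_measure R).

(** The Poisson kernel of the half plane without the factor 1 / pi, so that its total mass is pi. *)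
Definition poisson (e u : R) : R := e / (e ^+ 2 + u ^+ 2).

Lemma poisson_denom_gt0 (e u : R) : 0 < e -> 0 < e ^+ 2 + u ^+ 2.
Proof. by move=> e0; rewrite ltr_wpDr ?sqr_ge0// exprn_gt0. Qed.

Lemma poisson_ge0 (e u : R) : 0 < e -> 0 <= poisson e u.
Proof. by move=> e0; rewrite divr_ge0 ?ltW// poisson_denom_gt0. Qed.

Lemma continuous_poisson (e : R) : 0 < e -> continuous (poisson e).
Proof.
move=> e0 u; apply: cvgM; first exact: cvg_cst.
apply: cvgV; first by rewrite gt_eqF// poisson_denom_gt0.
by apply: cvgD; [exact: cvg_cst|exact: exprn_continuous].
Qed.

(** By [tau_mul] this is a combination of weighted integrals of single cosines. The difference
    frequency gives the kernel that concentrates on the diagonal, the sum frequency its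
    reflection. *)
Lemma Rintegral_expw_tau (e : R) m (s t : R) : 0 < e ->
  \int[mu]_x (expw e x * tau m (s * x) * tau m (t * x)) =
  poisson e (s - t) + (-1) ^+ m * poisson e (s + t).
Proof.
move=> e0.
have mc (u : R) : measurable_fun setT (fun x => cos (u * x)).
  apply: continuous_measurable_fun => x.
  apply: continuous_comp; last exact: continuous_cos.
  by apply: continuousM; [exact: cvg_cst|exact: cvg_id].
have ic (u : R) : mu.-integrable setT (EFin \o (fun x => expw e x * cos (u * x))).
  by apply: (@integrable_expwM _ _ e0 _ 1) => // x; exact: cos_max.
transitivity (\int[mu]_x (2^-1 * (expw e x * cos ((s - t) * x)) +
    2^-1 * (-1) ^+ m * (expw e x * cos ((s + t) * x)))).
  apply: eq_Rintegral => x _.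
  by rewrite -mulrA tau_mul -mulrBl -mulrDl; ring.
rewrite RintegralD//; last 2 first.
- by rewrite /comp; under eq_fun do rewrite EFinM; apply: integrableZl => //; exact: ic.
- by rewrite /comp; under eq_fun do rewrite EFinM; apply: integrableZl => //; exact: ic.
rewrite !RintegralZl// !Rintegral_expw_cos//.
rewrite -/(poisson e (s - t)) -/(poisson e (s + t)).
by move: ((-1) ^+ m) (poisson _ _) (poisson _ _) => x y z; field.
Qed.

Variables (a b : R) (a0 : 0 < a) (ab : a < b).

Lemma itv_measure : fine (mu `[a, b]) = b - a.
Proof. by rewrite /= lebesgue_measure_itv/= lte_fin ab. Qed.

Lemma continuous_integrable_itv (h : R -> R) : continuous h ->
  mu.-integrable `[a, b] (EFin \o h).
Proof.
move=> ch; apply: continuous_compact_integrable; first exact: segment_compact.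
exact: continuous_subspaceT.
Qed.

Lemma Rintegral_poisson (e s : R) : 0 < e ->
  \int[mu]_(t in `[a, b]) poisson e (s - t) =
  atan ((b - s) / e) + atan ((s - a) / e).
Proof.
move=> e0.
have D0 u : e ^+ 2 + u ^+ 2 != 0 by rewrite gt_eqF// poisson_denom_gt0.
pose F (t : R) : R := atan ((t - s) / e).
have dF (t : R) : is_derive t (1 : R) F (poisson e (s - t)).
  apply: is_derive_eq.
  rewrite /GRing.scale/= /poisson; field.
  by rewrite D0 gt_eqF.
have cF : continuous F.
  by move=> t; apply: differentiable_continuous; apply/derivable1_diffP; have [] := dF t.
rewrite /Rintegral (@continuous_FTC2 _ _ F)//=.
- by rewrite /F -[X in _ + X = _]atanN -mulNr opprB.
- apply: continuous_subspaceT => t; apply: (@continuous_comp _ _ _ (fun t => s - t) (poisson e)); last exact: continuous_poisson.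
  by apply: cvgB; [exact: cvg_cst|exact: cvg_id].
- split; first by move=> t _; have [] := dF t.
    by apply: cvg_at_right_filter; exact: cF.
  by apply: cvg_at_left_filter; exact: cF.
- by move=> t _; rewrite derive1E; have [_ ->] := dF t.
Qed.

Lemma Rintegral_poisson_le (e s : R) : 0 < e ->
  0 <= \int[mu]_(t in `[a, b]) poisson e (s - t) <= pi.
Proof.
move=> e0; apply/andP; split.
  by apply: Rintegral_ge0 => t _; exact: poisson_ge0.
rewrite Rintegral_poisson// [leRHS](_ : _ = pi / 2 + pi / 2); last by field.
by rewrite lerD// ltW// atan_ltpi2.
Qed.

End poisson_kernel.

Section transform.
Context {R : realType}.
Notation mu := (@lebesgue_measure R).
Variables (a b : R).

(** For [m = 0] the cosine transform, for [m = 1] minus the sine transform, of [f] restricted to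
    [[a, b]]. *)
Definition ctrans (m : nat) (f : R -> R) (x : R) : R :=
  \int[mu]_(s in `[a, b]) (f s * tau m (s * x)).

Hypotheses (a0 : 0 < a) (ab : a < b).

Let itv_fin := lebesgue_measure_itv_lty ab.

Variables (m : nat) (f : R -> R) (M : R).
Hypotheses (cf : continuous f) (fM : forall s, `|f s| <= M).

Lemma continuous_tauM (n : nat) (s : R) : continuous (fun x => tau n (s * x)).
Proof.
move=> x; apply: (@continuous_comp _ _ _ (fun x => s * x) (tau n)); last exact: continuous_tau.
by apply: cvgM; [exact: cvg_cst|exact: cvg_id].
Qed.

Lemma continuous_Mtau (n : nat) (x : R) : continuous (fun s : R => tau n (s * x)).
Proof.
move=> s; apply: (@continuous_comp _ _ _ (fun s : R => s * x) (tau n)); last exact: continuous_tau.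
by apply: cvgM; [exact: cvg_id|exact: cvg_cst].
Qed.

Lemma ftau_le s x : `|f s * tau m (s * x)| <= M.
Proof.
by rewrite normrM (le_trans _ (fM s))// ler_piMr// tau_le1.
Qed.

Lemma continuous_ftau x : continuous (fun s => f s * tau m (s * x)).
Proof.
move=> s; apply: cvgM; first exact: cf.
exact: continuous_Mtau.
Qed.

Lemma ctrans_le x : `|ctrans m f x| <= M * (b - a).
Proof.
rewrite -(itv_measure ab); apply: (normr_Rintegral_le _ itv_fin) => //.
  apply: measurable_funTS; apply: continuous_measurable_fun; exact: continuous_ftau.
by move=> s _; exact: ftau_le.
Qed.

Lemma continuous_ctrans : continuous (ctrans m f).
Proof.
apply: (@continuous_Rintegral_le_cst _ _ _ mu `[a, b] _ itv_fin (fun x s => f s * tau m (s * x)) M) => //.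
- by move=> p; apply: measurable_funTS; apply: continuous_measurable_fun; exact: continuous_ftau.
- move=> s _ x; apply: cvgM; first exact: cvg_cst.
  exact: continuous_tauM.
- by move=> x s _; exact: ftau_le.
Qed.

Lemma measurable_ftau : measurable_fun [set: measurableTypeR R * measurableTypeR R]
  (fun z => f z.2 * tau m (z.2 * z.1)).
Proof.
apply: (@caratheodory_measurable _ _ _ (fun x s => f s * tau m (s * x))).
  move=> s; apply: continuous_measurable_fun => x.
  by apply: cvgM; [exact: cvg_cst|exact: continuous_tauM].
by move=> x; exact: continuous_ftau.
Qed.

(** The purpose of the weight: [h] and the cosines are merely bounded, and [expw e] supplies the
    integrable majorant in [x] for exchanging the integrals. *)
Lemma ctrans_fubini (e C : R) (h : R -> R) : 0 < e ->
  measurable_fun setT h -> (forall x, `|h x| <= C) ->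
  \int[mu]_x (expw e x * h x * ctrans m f x) =
  \int[mu]_(s in `[a, b]) (f s * \int[mu]_x (expw e x * h x * tau m (s * x))).
Proof.
move=> e0 mh hC.
have ie (c : R) : mu.-integrable setT (EFin \o (fun x => expw e x * c)).
  by apply: (@integrable_expwM _ _ e0 (cst c) `|c|) => // x; rewrite /=.
have meh : measurable_fun setT (fun x => expw e x * h x).
  by apply: measurable_funM => //; exact: measurable_expw.
have [] := @Rfubini _ _ _ _ _ mu mu setT `[a, b]
  (fun x s => expw e x * h x * (f s * tau m (s * x)))
  (fun x => expw e x * C) (cst M).
- exact: measurableT.
- exact: measurable_itv.
- apply: measurable_funM; last exact: measurable_ftau.
  exact: (measurableT_comp meh measurable_fst).
- exact: ie.
- by apply: (@integrable_le_cst _ _ _ mu `[a, b] _ itv_fin _ `|M|).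
- move=> x s _ _; rewrite !normrM ler_pM//.
    by rewrite ger0_norm ?expw_ge0// ler_wpM2l ?expw_ge0.
  by rewrite -normrM ftau_le.
move=> E1 E2; transitivity (\int[mu]_x \int[mu]_(s in `[a, b])
    (expw e x * h x * (f s * tau m (s * x)))).
  apply: eq_Rintegral => x _; rewrite /ctrans RintegralZl//.
  by apply: continuous_integrable_itv; exact: continuous_ftau.
rewrite E1 -E2; apply: eq_Rintegral => s _.
rewrite -RintegralZl//; last first.
  rewrite (_ : (fun x => _) = fun x => expw e x * (h x * tau m (s * x))); last first.
    by apply/funext => x; rewrite mulrA.
  apply: (@integrable_expwM _ _ e0 _ C).
    by apply: measurable_funM => //; apply: continuous_measurable_fun; exact: continuous_tauM.
  by move=> x; rewrite normrM (le_trans _ (hC x))// ler_piMr// tau_le1.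
by apply: eq_Rintegral => x _; rewrite mulrCA.
Qed.

Definition kern (e s t : R) : R := poisson e (s - t) + (-1) ^+ m * poisson e (s + t).

(** The square is opened one factor at a time: [ctrans_fubini] is applied with [h] the transform
    itself, then with [h] a single cosine. *)
Lemma Rintegral_expw_ctrans2 (e : R) : 0 < e ->
  \int[mu]_x (expw e x * ctrans m f x ^+ 2) =
  \int[mu]_(s in `[a, b]) (f s * \int[mu]_(t in `[a, b]) (f t * kern e s t)).
Proof.
move=> e0.
under eq_Rintegral do rewrite expr2 mulrA.
rewrite (ctrans_fubini e0 _ ctrans_le); last first.
  exact: continuous_measurable_fun continuous_ctrans.
apply: eq_Rintegral => s _; congr (_ * _).
under eq_Rintegral do rewrite mulrAC.
rewrite (ctrans_fubini e0 _ (fun x => tau_le1 m (s * x))); last first.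
  apply: continuous_measurable_fun; exact: continuous_tauM.
by apply: eq_Rintegral => t _; rewrite Rintegral_expw_tau.
Qed.

End transform.

Section plancherel1.
Context {R : realType}.
Notation mu := (@lebesgue_measure R).
Variables (a b : R).
Hypotheses (a0 : 0 < a) (ab : a < b).

Let itv_fin := lebesgue_measure_itv_lty ab.

Let en (n : nat) : R := n.+1%:R^-1.

Let en_gt0 n : 0 < en n. Proof. by rewrite invr_gt0 ltr0n. Qed.

Let cvg_en : en n @[n --> \oo] --> 0.
Proof. exact: cvg_harmonic. Qed.

(** For [s] strictly inside, both arctangents tend to pi / 2. At an end point one of them stays 0
    and half of the mass is lost. *)
Lemma cvg_poisson_mass s : a < s -> s < b ->
  \int[mu]_(t in `[a, b]) poisson (en n) (s - t) @[n --> \oo] --> (pi : R).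
Proof.
move=> sa sb.
under eq_fun do rewrite Rintegral_poisson// /en !invrK.
rewrite (_ : pi = pi / 2 + pi / 2); last by field.
have nS : (n.+1%:R : R) @[n --> \oo] --> +oo.
  by have := @cvgr_idn R; rewrite -(cvg_shiftS (fun n => n%:R : R)).
have atanM (c : R) : 0 < c -> atan (c * n.+1%:R) @[n --> \oo] --> pi / 2.
  move=> c0; apply: (cvg_comp _ (fun x => atan (c * x)) nS).
  exact: (cvg_comp _ _ (gt0_cvgMry c0 (@cvg_id _ _)) (@cvgy_atan R)).
by apply: cvgD; apply: atanM; rewrite subr_gt0.
Qed.

Variables (m : nat) (f : R -> R) (M : R).
Hypotheses (cf : continuous f) (fM : forall s, `|f s| <= M).

Let M0 : 0 <= M. Proof. exact: le_trans (fM 0). Qed.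

Lemma continuous_poissonB (e s : R) : 0 < e -> continuous (fun t => poisson e (s - t)).
Proof.
move=> e0 t; apply: (@continuous_comp _ _ _ (fun t => s - t) (poisson e)).
  by apply: cvgB; [exact: cvg_cst|exact: cvg_id].
exact: continuous_poisson.
Qed.

Lemma continuous_poissonD (e s : R) : 0 < e -> continuous (fun t => poisson e (s + t)).
Proof.
move=> e0 t; apply: (@continuous_comp _ _ _ (fun t => s + t) (poisson e)).
  by apply: cvgD; [exact: cvg_cst|exact: cvg_id].
exact: continuous_poisson.
Qed.

Let continuous_fdiff e s : 0 < e ->
  continuous (fun t => (f t - f s) * poisson e (s - t)).
Proof.
move=> e0 t; apply: cvgM; last exact: continuous_poissonB.
by apply: cvgB; [exact: cf|exact: cvg_cst].
Qed.

Let cvg_fdiff s :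
  \int[mu]_(t in `[a, b]) ((f t - f s) * poisson (en n) (s - t)) @[n --> \oo] --> 0.
Proof.
apply/cvgr0Pnorm_le => e e0.
have pi0 : 0 < pi :> R := pi_gt0 R.
(* The kernel has mass at most pi, so a constant error [eta] contributes at most [e / 2]; the other
   half is left for the quadratic term. *)
pose eta := e / (2 * pi); have eta0 : 0 < eta by rewrite divr_gt0// mulr_gt0.
have /cvgrPdist_lt/(_ _ eta0)[d /= d0 fd] : f t @[t --> s] --> f s by exact: cf.
(* The Poisson kernel times [(s - t) ^+ 2] is at most [en n], so the part far
   from [s] is absorbed by a quadratic term. *)
pose K := 2 * M / d ^+ 2.
have K0 : 0 <= K by rewrite divr_ge0 ?mulr_ge0 ?exprn_ge0// ltW.
have fK t : `|f t - f s| <= eta + K * (s - t) ^+ 2.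
  have [std|std] := ltP (`|s - t|) d.
    by rewrite distrC (le_trans (ltW (fd t std)))// lerDl mulr_ge0// sqr_ge0.
  rewrite (le_trans (ler_normB _ _))// (le_trans (lerD (fM t) (fM s)))//.
  rewrite ler_wpDl ?(ltW eta0)// /K mulrAC ler_pdivlMr ?exprn_gt0//.
  rewrite [leLHS](_ : _ = 2 * M * d ^+ 2); last by ring.
  rewrite ler_wpM2l ?mulr_ge0// -(real_normK (num_real (s - t))).
  by rewrite lerXn2r// nnegrE// ltW.
near=> n.
have e1 := en_gt0 n.
have mf' : mu.-integrable `[a, b] (EFin \o (fun t => (f t - f s) * poisson (en n) (s - t))).
  by apply: continuous_integrable_itv; exact: continuous_fdiff.
have mP : mu.-integrable `[a, b] (EFin \o (fun t => poisson (en n) (s - t))).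
  by apply: continuous_integrable_itv; exact: continuous_poissonB.
have mC c : mu.-integrable `[a, b] (EFin \o (fun t : R => c : R)).
  by apply: continuous_integrable_itv => t; exact: cvg_cst.
apply: (le_trans (le_normr_Rintegral _ mf')) => //.
apply: (@le_trans _ _ (\int[mu]_(t in `[a, b]) (eta * poisson (en n) (s - t) + K * en n))).
  apply: le_Rintegral => //.
  - by apply: continuous_integrable_itv => t; apply: cvg_norm; exact: continuous_fdiff.
  - apply: continuous_integrable_itv => t; apply: cvgD; last exact: cvg_cst.
    by apply: cvgM; [exact: cvg_cst|exact: continuous_poissonB].
  - move=> t _; rewrite normrM (ger0_norm (poisson_ge0 _ e1)).
    apply: (le_trans (ler_wpM2r (poisson_ge0 _ e1) (fK t))).
    rewrite mulrDl lerD2l -mulrA ler_wpM2l// /poisson mulrCA ler_piMr ?(ltW e1)//.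
    by rewrite ler_pdivrMr ?poisson_denom_gt0// mul1r lerDr sqr_ge0.
rewrite RintegralD//; last first.
  apply: continuous_integrable_itv => t.
  by apply: cvgM; [exact: cvg_cst|exact: continuous_poissonB].
rewrite (RintegralZl _ _ mP)// Rintegral_cst// (itv_measure ab).
have etaE : eta * pi = e / 2 by rewrite /eta invfM mulrA mulfVK// gt_eqF.
rewrite [leRHS](_ : e = eta * pi + e / 2); last by rewrite etaE; field.
rewrite lerD//.
  by rewrite ler_wpM2l ?(ltW eta0)//; have /andP[] := Rintegral_poisson_le ab s e1.
have : K * (b - a) * en n <= e / 2.
  near: n.
  have : (K * (b - a) * en n) @[n --> \oo] --> K * (b - a) * 0.
    by apply: cvgM; [exact: cvg_cst|exact: cvg_en].
  rewrite mulr0 => /cvgr0Pnorm_le/(_ (e / 2)); rewrite divr_gt0// => /(_ isT).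
  by apply: filterS => n; apply: le_trans; exact: ler_norm.
by rewrite mulrAC.
Unshelve. all: by end_near. Qed.

(** Here positivity of the frequencies pays off: [s + t >= a] keeps the reflected kernel away from
    its peak. *)
Let far_le e s t : 0 < e -> a <= s -> a <= t -> `|f t * poisson e (s + t)| <= M / a ^+ 2 * e.
Proof.
move=> e0 sa ta; rewrite normrM (ger0_norm (poisson_ge0 _ e0)) -mulrA.
rewrite ler_pM// ?poisson_ge0// /poisson [leRHS]mulrC ler_wpM2l ?(ltW e0)//.
rewrite lef_pV2 ?posrE ?exprn_gt0// ?poisson_denom_gt0// ler_wpDl ?sqr_ge0//.
have t0 := le_trans (ltW a0) ta; have s0 := le_trans (ltW a0) sa.
by rewrite lerXn2r ?nnegrE ?addr_ge0 ?(ltW a0)// ler_wpDr.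
Qed.

Let continuous_ffar e s : 0 < e -> continuous (fun t => f t * poisson e (s + t)).
Proof. by move=> e0 t; apply: cvgM; [exact: cf|exact: continuous_poissonD]. Qed.

Let continuous_fnear e s : 0 < e -> continuous (fun t => f t * poisson e (s - t)).
Proof. by move=> e0 t; apply: cvgM; [exact: cf|exact: continuous_poissonB]. Qed.

Let int_far_le e s : 0 < e -> a <= s ->
  `|\int[mu]_(t in `[a, b]) (f t * poisson e (s + t))| <= M / a ^+ 2 * e * (b - a).
Proof.
move=> e0 sa; rewrite -(itv_measure ab); apply: (normr_Rintegral_le _ itv_fin) => //.
  by apply: measurable_funTS; apply: continuous_measurable_fun; exact: continuous_ffar.
by move=> t /=; rewrite in_itv/= => /andP[ta _]; exact: far_le.
Qed.

Let kernE e s : 0 < e -> \int[mu]_(t in `[a, b]) (f t * kern m e s t) =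
  \int[mu]_(t in `[a, b]) (f t * poisson e (s - t)) +
  (-1) ^+ m * \int[mu]_(t in `[a, b]) (f t * poisson e (s + t)).
Proof.
move=> e0; rewrite -RintegralZl//; last first.
  by apply: continuous_integrable_itv; exact: continuous_ffar.
rewrite -RintegralD//.
- by apply: eq_Rintegral => t _; rewrite /kern mulrDr; congr (_ + _); rewrite mulrCA.
- by apply: continuous_integrable_itv; exact: continuous_fnear.
- apply: continuous_integrable_itv => t.
  by apply: cvgM; [exact: cvg_cst|exact: continuous_ffar].
Qed.

(** Write [f t] as [(f t - f s) + f s] in the diagonal kernel: the first part tends to 0, the second
    carries the mass pi, and the reflected kernel vanishes in the limit. *)
Let cvg_kern s : a < s -> s < b ->
  \int[mu]_(t in `[a, b]) (f t * kern m (en n) s t) @[n --> \oo] --> f s * pi.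
Proof.
move=> sa sb.
rewrite (_ : (fun n => _) = (fun n =>
    \int[mu]_(t in `[a, b]) ((f t - f s) * poisson (en n) (s - t)) +
    f s * \int[mu]_(t in `[a, b]) poisson (en n) (s - t) +
    (-1) ^+ m * \int[mu]_(t in `[a, b]) (f t * poisson (en n) (s + t)))); last first.
  apply/funext => n; rewrite kernE//; congr (_ + _).
  have mP : mu.-integrable `[a, b] (EFin \o (fun t => poisson (en n) (s - t))).
    by apply: continuous_integrable_itv; exact: continuous_poissonB.
  rewrite -RintegralZl// -RintegralD//.
  - by apply: eq_Rintegral => t _; rewrite -mulrDl subrK.
  - by apply: continuous_integrable_itv; exact: continuous_fdiff.
  - apply: continuous_integrable_itv => t.
    by apply: cvgM; [exact: cvg_cst|exact: continuous_poissonB].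
rewrite -[X in _ --> X]addr0 -[X in _ --> X + _]add0r; apply: cvgD.
  apply: cvgD; first exact: cvg_fdiff.
  by apply: cvgM; [exact: cvg_cst|exact: cvg_poisson_mass].
rewrite -(mulr0 ((-1) ^+ m)); apply: cvgM; first exact: cvg_cst.
have c0 : M / a ^+ 2 * en n * (b - a) @[n --> \oo] --> 0.
  rewrite -(mul0r (b - a)) -(mulr0 (M / a ^+ 2)).
  by apply: cvgM; [apply: cvgM; [exact: cvg_cst|exact: cvg_en]|exact: cvg_cst].
apply: norm_cvg0; apply: (squeeze_cvgr _ (cvg_cst 0) c0).
by apply: nearW => n; rewrite normr_ge0 int_far_le// ltW.
Qed.

(** A majorant uniform in [n] and [s], for dominated convergence in the outer integral. *)
Let kern_bound : exists C, forall n s, a <= s ->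
  `|\int[mu]_(t in `[a, b]) (f t * kern m (en n) s t)| <= C.
Proof.
exists (M * pi + M / a ^+ 2 * 1 * (b - a)) => n s sa; rewrite kernE//.
have e1 := en_gt0 n.
rewrite (le_trans (ler_normD _ _))// lerD//.
  apply: le_trans (le_normr_Rintegral _ _) _ => //.
    by apply: continuous_integrable_itv; exact: continuous_fnear.
  apply: (@le_trans _ _ (\int[mu]_(t in `[a, b]) (M * poisson (en n) (s - t)))).
    apply: le_Rintegral => //.
    - by apply: continuous_integrable_itv => t; apply: cvg_norm; exact: continuous_fnear.
    - apply: continuous_integrable_itv => t.
      by apply: cvgM; [exact: cvg_cst|exact: continuous_poissonB].
    - move=> t _; rewrite normrM (ger0_norm (poisson_ge0 _ e1)).
      by rewrite ler_wpM2r ?poisson_ge0.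
  rewrite RintegralZl//; last first.
    by apply: continuous_integrable_itv; exact: continuous_poissonB.
  by rewrite ler_wpM2l//; have /andP[] := Rintegral_poisson_le ab s e1.
rewrite normrM normrX normrN1 expr1n mul1r (le_trans (int_far_le e1 sa))//.
rewrite ler_wpM2r ?subr_ge0 ?(ltW ab)// ler_wpM2l ?divr_ge0 ?exprn_ge0 ?(ltW a0)//.
by rewrite invf_le1 ?ler1n ?ltr0n.
Qed.

Let measurable_fkern e : 0 < e ->
  measurable_fun setT (fun s => \int[mu]_(t in `[a, b]) (f t * kern m e s t)).
Proof.
move=> e0; apply: (@measurable_fun_Rintegral_param _ _ _ (fun s t => f t * kern m e s t)) => //.
have cP (u : R) : continuous (fun t => poisson e (u + t)) by exact: continuous_poissonD.
apply: (@caratheodory_measurable _ _ _ (fun s t => f t * kern m e s t)) => [t|s].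
  apply: continuous_measurable_fun => s; apply: cvgM; first exact: cvg_cst.
  apply: cvgD.
    by rewrite addrC; under eq_fun do rewrite addrC; exact: cP.
  apply: cvgM; first exact: cvg_cst.
  by rewrite addrC; under eq_fun do rewrite addrC; exact: cP.
move=> t; apply: cvgM; first exact: cf.
apply: cvgD; first exact: continuous_poissonB.
by apply: cvgM; [exact: cvg_cst|exact: continuous_poissonD].
Qed.

(** The weighted identity holds for each [en n]. Its left side passes to the limit by monotone
    convergence, its right side by dominated convergence, and the two limits must agree. *)
Lemma plancherel1 : (\int[mu]_x ((ctrans a b m f x) ^+ 2)%:E =
  (pi * \int[mu]_(s in `[a, b]) f s ^+ 2)%:E)%E.
Proof.
set h := ctrans a b m f.
have mh : measurable_fun setT h.
  by apply: continuous_measurable_fun; exact: continuous_ctrans fM.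
have h2M x : `|h x ^+ 2| <= (M * (b - a)) ^+ 2.
  rewrite normrX lerXn2r ?nnegrE//; last exact: ctrans_le.
  by rewrite mulr_ge0// subr_ge0 ltW.
have mh2 : measurable_fun setT (fun x => h x ^+ 2) by exact: measurable_funX.
have int_s n : (\int[mu]_x (expw (en n) x * h x ^+ 2)%:E =
    \int[mu]_(s in `[a, b]) (f s * \int[mu]_(t in `[a, b]) (f t * kern m (en n) s t))%:E)%E.
  have i1 := integrable_expwM (en_gt0 n) mh2 h2M.
  rewrite -(fineK (integrable_fin_num _ i1))// -/(Rintegral _ _ _).
  rewrite (Rintegral_expw_ctrans2 ab m cf fM)// fineK//.
  apply: integrable_fin_num => //.
  have [C kC] := kern_bound.
  apply: (@integrable_le_cst _ _ _ mu `[a, b] _ itv_fin _ (M * C)) => //.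
    apply: measurable_funTS; apply: measurable_funM; last exact: measurable_fkern.
    exact: continuous_measurable_fun.
  by move=> s /=; rewrite in_itv/= => /andP[sa _]; rewrite normrM ler_pM// kC.
(* The weights increase to 1 with [n]; monotone convergence works before the limit is known to be
   finite. *)
have L : (\int[mu]_x (expw (en n) x * h x ^+ 2)%:E)%E @[n --> \oo] --> (\int[mu]_x (h x ^+ 2)%:E)%E.
  rewrite (_ : (\int[mu]_x (h x ^+ 2)%:E)%E =
    (\int[mu]_x limn (fun n => (expw (en n) x * h x ^+ 2)%:E))%E); last first.
    apply: eq_integral => x _; apply/esym/cvg_lim => //; apply: cvg_EFin; first exact: nearW.
    rewrite -[X in _ --> X]mul1r; apply: cvgM; last exact: cvg_cst.
    rewrite /expw -expR0; apply: (@cvg_comp _ _ _ (fun n => - (en n * `|x|)) expR);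
      last exact: continuous_expR.
    rewrite -oppr0 -(mul0r `|x|).
    by apply: cvgN; apply: cvgM; [exact: cvg_en|exact: cvg_cst].
  apply: (@cvg_monotone_convergence _ _ _ mu setT measurableT
    (fun n x => (expw (en n) x * h x ^+ 2)%:E)).
  - move=> n; apply/measurable_EFinP; apply: measurable_funM => //.
    by apply: measurable_expw; exact: en_gt0.
  - by move=> n x _; rewrite lee_fin mulr_ge0 ?expw_ge0// sqr_ge0.
  - move=> x _ i j ij; rewrite lee_fin ler_wpM2r ?sqr_ge0// /expw ler_expR lerN2.
    by rewrite ler_wpM2r// lef_pV2 ?posrE ?ltr0n// ler_nat.
have [C kC] := kern_bound.
have E : (\int[mu]_(s in `[a, b]) (f s * (f s * pi))%:E =
    (pi * \int[mu]_(s in `[a, b]) f s ^+ 2)%:E)%E.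
  have cf2 : continuous (fun s => f s ^+ 2).
    by move=> s; exact: (cvgM (@cf s) (@cf s)).
  under eq_integral do rewrite mulrA -expr2 mulrC.
  rewrite -RintegralZl//; last exact: continuous_integrable_itv.
  rewrite /Rintegral fineK//; apply: integrable_fin_num => //.
  by apply: continuous_integrable_itv => s; apply: cvgM; [exact: cvg_cst|exact: cf2].
rewrite -E; apply: (cvg_unique _ L); first exact: ereal_hausdorff.
rewrite (_ : (fun n => _) = (fun n =>
   \int[mu]_(s in `[a, b]) (f s * \int[mu]_(t in `[a, b]) (f t * kern m (en n) s t))%:E)%E); last first.
  by apply/funext => n; exact: int_s.
have [| | | | | |_ _] := @dominated_convergence _ _ _ mu `[a, b] _
  (fun n s => (f s * \int[mu]_(t in `[a, b]) (f t * kern m (en n) s t))%:E)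
  (fun s => (f s * (f s * pi))%:E) (cst (M * C)%:E).
- exact: measurable_itv.
- move=> n; apply/measurable_EFinP; apply: measurable_funTS.
  apply: measurable_funM; last exact: measurable_fkern.
  exact: continuous_measurable_fun.
- apply/measurable_EFinP; apply: measurable_funTS; apply: continuous_measurable_fun => s.
  by apply: cvgM; [exact: cf|apply: cvgM; [exact: cf|exact: cvg_cst]].
(* At the two end points the kernel keeps only half of its mass, so they are put in the exceptional
   null set. *)
- exists [set a; b]; split.
  + exact: measurableU.
  + by apply: countable_lebesgue_measure0; apply: finite_set_countable.
  + move=> s /= /not_implyP[]; rewrite in_itv/= => /andP[sa sb] nc.
    apply: contrapT => /not_orP[/eqP nsa /eqP nsb]; apply: nc.
    apply: cvg_EFin; first exact: nearW.
    apply: cvgM; first exact: cvg_cst.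
    by apply: cvg_kern; rewrite lt_neqAle ?sa ?sb ?andbT// eq_sym.
- by apply: (@integrable_le_cst _ _ _ mu `[a, b] _ itv_fin (cst (M * C)) `|M * C|).
- apply: aeW => s n; rewrite /= in_itv/= => /andP[sa sb].
  by rewrite lee_fin normrM ler_pM// kC.
- exact.
Qed.

End plancherel1.

(** * From one to three variables *)

Section plancherel_param.
Context {R : realType} d (Y : measurableType d).
Variable (nu : {sigma_finite_measure set Y -> \bar R}).
Notation mu := (@lebesgue_measure R).
Variables (a b : R).
Hypotheses (a0 : 0 < a) (ab : a < b).
Variables (m : nat) (H : Y -> R -> R) (M : R).
Hypotheses (mH : measurable_fun [set: Y * measurableTypeR R] (fun z => H z.1 z.2))
  (cH : forall y, continuous (H y)) (HM : forall y s, `|H y s| <= M).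

Lemma measurable_ctrans_param :
  measurable_fun [set: Y * measurableTypeR R] (fun z => ctrans a b m (H z.1) z.2).
Proof.
apply: (@caratheodory_measurable _ _ _ (fun y x => ctrans a b m (H y) x)) => [x|y].
  apply: (@measurable_fun_Rintegral_param _ _ _ (fun y s => H y s * tau m (s * x))) => //.
  apply: measurable_funM => //.
  apply: (measurableT_comp (f := fun s : measurableTypeR R => tau m (s * x))) => //.
  apply: continuous_measurable_fun; exact: continuous_Mtau.
by apply: (@continuous_ctrans _ a b ab m (H y) M).
Qed.

(** The inductive step on the dimension. The integral over the parameter ends up innermost, where
    [H y s] may itself be a transform in [y] to which Plancherel applies again. *)
Lemma plancherel_param :
  (\int[(nu \x mu)%E]_z ((ctrans a b m (H z.1) z.2) ^+ 2)%:E =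
   pi%:E * \int[mu]_(s in `[a, b]) \int[nu]_y (H y s ^+ 2)%:E)%E.
Proof.
have mc2 : measurable_fun [set: Y * measurableTypeR R]
    (fun z => ((ctrans a b m (H z.1) z.2) ^+ 2)%:E).
  by apply/measurable_EFinP/measurable_funX; exact: measurable_ctrans_param.
rewrite (fubini_tonelli1 _ mc2); last by move=> z; rewrite lee_fin sqr_ge0.
rewrite /fubini_F/=.
pose f (z : Y * measurableTypeR R) : \bar R := (H z.1 z.2 ^+ 2 * \1_(`[a, b]%classic) z.2)%:E.
have mf : measurable_fun setT f.
  apply/measurable_EFinP; apply: measurable_funM; first exact: measurable_funX.
  apply: (measurableT_comp (f := fun x : measurableTypeR R => \1_(`[a, b]%classic) x : R)) => //.
  exact: measurable_indic.
have f0 z : (0 <= f z)%E by rewrite lee_fin mulr_ge0// sqr_ge0.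
transitivity (\int[nu]_y (pi%:E * \int[mu]_s f (y, s)))%E.
  apply: eq_integral => y _.
  rewrite (plancherel1 a0 ab m (@cH y) (HM y)) EFinM; congr (_ * _)%E.
  have iH : mu.-integrable `[a, b] (EFin \o (fun s => H y s ^+ 2)).
    by apply: continuous_integrable_itv => s; exact: (cvgM (@cH y s) (@cH y s)).
  rewrite /Rintegral fineK ?integrable_fin_num// integral_mkcond.
  apply: eq_integral => s _; rewrite patchE /f/= indicE.
  by case: (s \in _); rewrite ?mulr1 ?mulr0.
rewrite ge0_integralZl//; last 3 first.
- by apply: (@measurable_fun_fubini_tonelli_F _ _ _ _ _ mu f).
- by move=> y _; apply: integral_ge0 => s _.
- by rewrite lee_fin pi_ge0.
congr (_ * _)%E; rewrite -(@fubini_tonelli1 _ _ _ _ _ nu mu f mf f0).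
rewrite (@fubini_tonelli2 _ _ _ _ _ nu mu f mf f0) [RHS]integral_mkcond.
apply: eq_integral => s _; rewrite patchE /fubini_G /f/= indicE.
case: (s \in _); last by rewrite integral0_eq// => y _; rewrite mulr0.
by apply: eq_integral => y _; rewrite mulr1.
Qed.

End plancherel_param.

Section plancherel23.
Context {R : realType}.
Notation mu := (@lebesgue_measure R).
Variables (a b : R).
Hypotheses (a0 : 0 < a) (ab : a < b).

Let itv_fin := lebesgue_measure_itv_lty ab.

Lemma continuous_ctrans_param (m : nat) (h : R -> R -> R) (M x : R) :
  (forall p, continuous (h p)) -> (forall s, continuous (h ^~ s)) ->
  (forall p s, `|h p s| <= M) ->
  continuous (fun p => ctrans a b m (h p) x).
Proof.
move=> ch1 ch2 hM.
apply: (@continuous_Rintegral_le_cst _ _ _ mu `[a, b] _ itv_fin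
  (fun p s => h p s * tau m (s * x)) M) => //.
- move=> p; apply: measurable_funTS; apply: continuous_measurable_fun.
  exact: continuous_ftau.
- by move=> s _ p; apply: cvgM; [exact: ch2|exact: cvg_cst].
- by move=> p s _; exact: ftau_le.
Qed.

Lemma continuous_Rintegral_sqr (h : R -> R -> R) (M : R) :
  (forall p, continuous (h p)) -> (forall s, continuous (h ^~ s)) ->
  (forall p s, `|h p s| <= M) ->
  continuous (fun p => \int[mu]_(s in `[a, b]) h p s ^+ 2).
Proof.
move=> ch1 ch2 hM.
apply: (@continuous_Rintegral_le_cst _ _ _ mu `[a, b] _ itv_fin
  (fun p s => h p s ^+ 2) (M ^+ 2)) => //.
- move=> p; apply: measurable_funTS; apply: continuous_measurable_fun => s.
  exact: (cvgM (@ch1 p s) (@ch1 p s)).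
- by move=> s _ p; exact: (cvgM (@ch2 s p) (@ch2 s p)).
- by move=> p s _; rewrite normrX lerXn2r ?nnegrE// (le_trans _ (hM p s)).
Qed.

Lemma plancherel2 (m0 m1 : nat) (g : R -> R -> R) (M : R) :
  (forall p, continuous (g p)) -> (forall s, continuous (g ^~ s)) ->
  (forall p s, `|g p s| <= M) ->
  (\int[(mu \x mu)%E]_z
     ((ctrans a b m1 (fun t => ctrans a b m0 (g ^~ t) z.1) z.2) ^+ 2)%:E =
   (pi ^+ 2 * \int[mu]_(t in `[a, b]) \int[mu]_(s in `[a, b]) g s t ^+ 2)%:E)%E.
Proof.
move=> cg1 cg2 gM.
have cH (x : R) : continuous (fun t => ctrans a b m0 (g ^~ t) x).
  by apply: (@continuous_ctrans_param _ (fun t s => g s t) M).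
have HM (x t : R) : `|ctrans a b m0 (g ^~ t) x| <= M * (b - a).
  by apply: ctrans_le.
rewrite (@plancherel_param _ _ _ mu _ _ a0 ab m1
  (fun x t => ctrans a b m0 (g ^~ t) x) (M * (b - a)))//; last first.
  apply: (@caratheodory_measurable _ _ _ (fun x t => ctrans a b m0 (g ^~ t) x)) => // t.
  by apply: continuous_measurable_fun; apply: (@continuous_ctrans _ _ _ _ _ _ M).
rewrite expr2 -mulrA EFinM; congr (_ * _)%E.
have cI : continuous (fun t => \int[mu]_(s in `[a, b]) g s t ^+ 2).
  by apply: (@continuous_Rintegral_sqr (fun t s => g s t) M).
rewrite EFinM [in RHS]/Rintegral fineK; last first.
  by apply: integrable_fin_num => //; exact: continuous_integrable_itv.
rewrite -ge0_integralZl//; last 3 first.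
- by apply/measurable_EFinP; apply: measurable_funTS; exact: continuous_measurable_fun.
- by move=> t _; rewrite lee_fin Rintegral_ge0// => s _; rewrite sqr_ge0.
- by rewrite lee_fin pi_ge0.
by apply: eq_integral => t _; rewrite (@plancherel1 _ _ _ a0 ab m0 (g ^~ t) M).
Qed.

End plancherel23.

Section lebesgue2.
Context {R : realType}.
Notation mu := (@lebesgue_measure R).

(* Type inference finds the sigma-finite structure of a product measure only
   when the factors are subprobabilities, hence this named copy. *)
Definition lebesgue2 : set (measurableTypeR R * measurableTypeR R) -> \bar R :=
  (mu \x mu)%E.

HB.instance Definition _ := Measure.on lebesgue2.

Lemma lebesgue2_sigma_finite : sigma_finite setT lebesgue2.
Proof.
have /sigma_finiteP[F [TF ndF Foo]] := sigma_finiteT mu.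
exists (fun n => F n `*` F n).
  rewrite -setXTT TF predeqE => -[x y]; split.
    move=> [/= [n _ Fnx] [k _ Fky]]; exists (maxn n k) => //; split.
    - by move: x Fnx; exact/subsetPset/ndF/leq_maxl.
    - by move: y Fky; exact/subsetPset/ndF/leq_maxr.
  by move=> [n _ []/= ? ?]; split; exists n.
move=> k; have [? ?] := Foo k; split; first exact: measurableX.
by rewrite /lebesgue2 product_measure1E// lte_mul_pinfty// ge0_fin_numE.
Qed.

HB.instance Definition _ := Measure_isSigmaFinite.Build _ _ _ lebesgue2
  lebesgue2_sigma_finite.

End lebesgue2.

Section plancherel3.
Context {R : realType}.
Notation mu := (@lebesgue_measure R).
Variables (a b : R).
Hypotheses (a0 : 0 < a) (ab : a < b).

Let itv_fin := lebesgue_measure_itv_lty ab.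

Lemma measurable_separately_continuous (g : R -> R -> R -> R) :
  (forall y z, continuous (fun x => g x y z)) ->
  (forall x z, continuous (fun y => g x y z)) ->
  (forall x y, continuous (fun z => g x y z)) ->
  measurable_fun [set: mR3 R] (fun w => g w.1.1 w.1.2 w.2).
Proof.
move=> c1 c2 c3.
apply: (@caratheodory_measurable _ _ _ (fun w z => g w.1 w.2 z)) => // z.
apply: (@caratheodory_measurable _ _ _ (fun x y => g x y z)) => // y.
exact: continuous_measurable_fun.
Qed.

Variables (m0 m1 m2 : nat) (g : R -> R -> R -> R) (M : R).
Hypotheses (c1 : forall y z, continuous (fun x => g x y z))
  (c2 : forall x z, continuous (fun y => g x y z))
  (c3 : forall x y, continuous (fun z => g x y z))
  (gM : forall x y z, `|g x y z| <= M).

(** Frequencies are traded for positions one at a time: in [iter1] only the first argument is a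
    position, in [iter2] the first two, in [iter3] all of them. *)
Definition iter1 (x y z : R) : R := ctrans a b m0 (fun s => g s y z) x.
Definition iter2 (x y z : R) : R := ctrans a b m1 (fun t => iter1 x t z) y.
Definition iter3 (x y z : R) : R := ctrans a b m2 (fun t => iter2 x y t) z.

Lemma iter1_le x y z : `|iter1 x y z| <= M * (b - a).
Proof. by apply: ctrans_le. Qed.

Lemma continuous_iter1x y z : continuous (fun x => iter1 x y z).
Proof. by apply: (@continuous_ctrans _ a b ab m0 (fun s => g s y z) M). Qed.

Lemma continuous_iter1y x z : continuous (fun y => iter1 x y z).
Proof. by apply: (@continuous_ctrans_param _ _ _ ab _ (fun y s => g s y z) M). Qed.

Lemma continuous_iter1z x y : continuous (fun z => iter1 x y z).
Proof. by apply: (@continuous_ctrans_param _ _ _ ab _ (fun z s => g s y z) M). Qed.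

Lemma iter2_le x y z : `|iter2 x y z| <= M * (b - a) * (b - a).
Proof.
apply: ctrans_le => //; first exact: continuous_iter1y.
by move=> t; exact: iter1_le.
Qed.

Lemma continuous_iter2x y z : continuous (fun x => iter2 x y z).
Proof.
apply: (@continuous_ctrans_param _ _ _ ab _ (fun x t => iter1 x t z) (M * (b - a))).
- by move=> x; exact: continuous_iter1y.
- by move=> t; exact: continuous_iter1x.
- by move=> x t; exact: iter1_le.
Qed.

Lemma continuous_iter2y x z : continuous (fun y => iter2 x y z).
Proof.
apply: (@continuous_ctrans _ a b ab m1 (fun t => iter1 x t z) (M * (b - a))).
  exact: continuous_iter1y.
by move=> t; exact: iter1_le.
Qed.

Lemma continuous_iter2z x y : continuous (fun z => iter2 x y z).
Proof.
apply: (@continuous_ctrans_param _ _ _ ab _ (fun z t => iter1 x t z) (M * (b - a))).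
- by move=> z; exact: continuous_iter1y.
- by move=> t; exact: continuous_iter1z.
- by move=> x' t; exact: iter1_le.
Qed.

(** [plancherel_param] over the plane treats the last variable; for each fixed last frequency
    [plancherel2] treats the other two. *)
Lemma plancherel3 :
  (\int[lebesgue3 R]_w ((iter3 w.1.1 w.1.2 w.2) ^+ 2)%:E =
   (pi ^+ 3 * \int[mu]_(z in `[a, b]) \int[mu]_(y in `[a, b])
     \int[mu]_(x in `[a, b]) g x y z ^+ 2)%:E)%E.
Proof.
have gM2 x y z : `|g x y z ^+ 2| <= M ^+ 2.
  by rewrite normrX lerXn2r ?nnegrE// (le_trans _ (gM x y z)).
have gc2 (h : R -> R) : continuous h -> continuous (fun x => h x ^+ 2).
  by move=> ch x; exact: (cvgM (@ch x) (@ch x)).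
rewrite /= (@plancherel_param _ _ _ (@lebesgue2 R) _ _ a0 ab m2
  (fun w z => iter2 w.1 w.2 z) (M * (b - a) * (b - a)))//; last 3 first.
- apply: measurable_separately_continuous.
  + by move=> y z; exact: continuous_iter2x.
  + by move=> y z; exact: continuous_iter2y.
  + by move=> y z; exact: continuous_iter2z.
- by move=> w; exact: continuous_iter2z.
- by move=> w z; exact: iter2_le.
pose I1 y z := \int[mu]_(x in `[a, b]) g x y z ^+ 2.
have I1_le y z : `|I1 y z| <= M ^+ 2 * (b - a).
  rewrite -(itv_measure ab); apply: (normr_Rintegral_le _ itv_fin) => //.
  by apply: measurable_funTS; apply: continuous_measurable_fun; exact: gc2.
have cI1y z : continuous (fun y => I1 y z).
  by apply: (@continuous_Rintegral_sqr _ _ _ ab (fun y x => g x y z) M).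
have cI1z y : continuous (fun z => I1 y z).
  by apply: (@continuous_Rintegral_sqr _ _ _ ab (fun z x => g x y z) M).
pose I2 z := \int[mu]_(y in `[a, b]) I1 y z.
have cI2 : continuous I2.
  apply: (@continuous_Rintegral_le_cst _ _ _ mu `[a, b] _ itv_fin
    (fun z y => I1 y z) (M ^+ 2 * (b - a))) => //.
  by move=> z; apply: measurable_funTS; exact: continuous_measurable_fun.
rewrite -/(I2 _) (_ : pi ^+ 3 = pi * pi ^+ 2)// -mulrA EFinM; congr (_ * _)%E.
rewrite EFinM [in RHS]/Rintegral fineK; last first.
  by apply: integrable_fin_num => //; exact: continuous_integrable_itv.
rewrite -ge0_integralZl//; last 3 first.
- by apply/measurable_EFinP; apply: measurable_funTS; exact: continuous_measurable_fun.
- move=> t _; rewrite lee_fin Rintegral_ge0// => s _.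
  by rewrite Rintegral_ge0// => ? _; rewrite sqr_ge0.
- by rewrite lee_fin exprn_ge0// pi_ge0.
apply: eq_integral => z _; rewrite -EFinM.
by rewrite (@plancherel2 _ _ _ a0 ab m0 m1 (fun x y => g x y z) M).
Qed.

End plancherel3.

(** * Fourier synthesis over a box *)

Section coordinates.
Context {R : realType}.

(** Every index from 2 on denotes the last coordinate, so statements may range over all natural
    numbers, as in [boxP]. *)
Definition coord3 (i : nat) (x : R3 R) : R :=
  match i with 0%N => x.1.1 | 1%N => x.1.2 | _ => x.2 end.

Definition upd3 (i : nat) (s : R) (x : R3 R) : R3 R :=
  match i with 0%N => (s, x.1.2, x.2) | 1%N => (x.1.1, s, x.2) | _ => (x.1, s) end.

Lemma coord3_upd3_eq i s x : coord3 i (upd3 i s x) = s.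
Proof. by case: i => [|[|i]]. Qed.

Lemma coord3_upd3_neq (i j : 'I_3) s x : j != i -> coord3 j (upd3 i s x) = coord3 j x.
Proof. by case: i => -[|[|[|i]]]//= ?; case: j => -[|[|[|j]]]//= ?. Qed.

Lemma upd3_upd3 i s t x : upd3 i s (upd3 i t x) = upd3 i s x.
Proof. by case: i => [|[|i]]. Qed.

Lemma upd3_coord3 i x : upd3 i (coord3 i x) x = x.
Proof. by case: i => [|[|i]]; case: x => -[]. Qed.

Lemma continuous_coord3 i : continuous (coord3 i).
Proof.
case: i => [|[|i]] x.
- exact: (cvg_comp _ _ cvg_fst cvg_fst).
- exact: (cvg_comp _ _ cvg_fst cvg_snd).
- exact: cvg_snd.
Qed.

Lemma continuous_upd3 i x : continuous (fun s => upd3 i s x).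
Proof.
case: i => [|[|i]] s /=.
- exact: (cvg_pair (cvg_pair (@cvg_id _ (nbhs s)) (cvg_cst x.1.2)) (cvg_cst x.2)).
- exact: (cvg_pair (cvg_pair (cvg_cst x.1.1) (@cvg_id _ (nbhs s))) (cvg_cst x.2)).
- exact: (cvg_pair (cvg_cst x.1) (@cvg_id _ (nbhs s))).
Qed.

Lemma measurable_continuous_upd3 (g : R3 R -> R) :
  (forall i x, continuous (fun s => g (upd3 i s x))) ->
  measurable_fun [set: mR3 R] (g : mR3 R -> R).
Proof.
move=> cg.
have := @measurable_separately_continuous R (fun x y z => g (x, y, z)).
rewrite [X in _ -> _ -> _ -> measurable_fun _ X](_ : _ = g); last first.
  by apply/funext => -[[]].
apply => [y z|x z|x y].
- exact: (cg 0%N (0, y, z)).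
- exact: (cg 1%N (x, 0, z)).
- exact: (cg 2%N (x, y, 0)).
Qed.

Lemma measurable_continuous3 (g : R3 R -> R) : continuous g ->
  measurable_fun [set: mR3 R] (g : mR3 R -> R).
Proof.
move=> cg; apply: measurable_continuous_upd3 => i x s.
by apply: continuous_comp; [exact: continuous_upd3|exact: cg].
Qed.

End coordinates.

Section box.
Context {R : realType}.
Notation mu := (@lebesgue_measure R).

Definition box (a b : R) : set (R3 R) := (`[a, b] `*` `[a, b]) `*` `[a, b].

Lemma boxP a b xi : box a b xi <-> forall i, a <= coord3 i xi <= b.
Proof.
rewrite /box /=; split => [[[]]|H].
  by rewrite /= !in_itv/= => ? ? ? [|[|i]].
by have := (H 0%N, H 1%N, H 2%N); rewrite /= !in_itv/= => -[[-> ->] ->].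
Qed.

Lemma compact_box a b : compact (box a b).
Proof. by apply: compact_setX; first apply: compact_setX; exact: segment_compact. Qed.

Lemma continuous_box_le a b (g : R3 R -> R) : continuous g ->
  exists C, 0 <= C /\ forall xi, box a b xi -> `|g xi| <= C.
Proof.
move=> cg; have /compact_bounded[M [Mr gM]] : compact (g @` box a b).
  apply: continuous_compact; last exact: compact_box.
  exact: continuous_subspaceT.
exists (`|M| + 1); split; first by rewrite addr_ge0.
move=> xi xib; apply: (gM (`|M| + 1)); last by exists xi.
by rewrite (le_lt_trans (ler_norm M))// ltrDl.
Qed.

Variables (a b : R).
Hypothesis (ab : a < b).

Let itv_fin := lebesgue_measure_itv_lty ab.

Lemma lebesgue2_itv_lty : (@lebesgue2 R (`[a, b] `*` `[a, b]) < +oo)%E.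
Proof.
rewrite /lebesgue2 product_measure1E//; apply: lte_mul_pinfty => //.
by rewrite ge0_fin_numE.
Qed.

Lemma measurable_box : measurable (box a b : set (mR3 R)).
Proof. by apply: measurableX => //; apply: measurableX. Qed.

Lemma lebesgue3_boxE : lebesgue3 R (box a b) = ((b - a) ^+ 3)%:E.
Proof.
rewrite /lebesgue3 /= (@product_measure1E _ _ _ _ _ (@lebesgue2 R) mu)//; last first.
  exact: measurableX.
rewrite [X in (X * _)%E](@product_measure1E _ _ _ _ _ mu mu)//.
transitivity ((b - a)%:E * (b - a)%:E * (b - a)%:E)%E.
  by congr (_ * _ * _)%E; rewrite /= lebesgue_measure_itv/= lte_fin ab EFinD.
by rewrite -!EFinM !exprS expr0 mulr1 mulrA.
Qed.

Lemma lebesgue3_box_fin : (lebesgue3 R (box a b) < +oo)%E.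
Proof. by rewrite lebesgue3_boxE ltry. Qed.

Lemma integrable_box (g : R3 R -> R) : continuous g ->
  (lebesgue3 R).-integrable (box a b) (EFin \o g).
Proof.
move=> cg; have [C [_ gC]] := continuous_box_le a b cg.
apply: (integrable_le_cst _ lebesgue3_box_fin _ gC); first exact: measurable_box.
by apply: measurable_funTS; exact: measurable_continuous3.
Qed.

Lemma Rintegral_box (h : R3 R -> R) : continuous h ->
  \int[lebesgue3 R]_(xi in box a b) h xi =
  \int[mu]_(z in `[a, b]) \int[mu]_(y in `[a, b]) \int[mu]_(x in `[a, b]) h (x, y, z).
Proof.
move=> ch; have [C [C0 hC]] := continuous_box_le a b ch.
have mh := measurable_continuous3 ch.
have [] := @Rfubini _ _ _ _ _ (@lebesgue2 R) mu (`[a, b] `*` `[a, b]) `[a, b]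
   (fun w z => h (w, z)) (cst C) (cst 1).
- exact: measurableX.
- exact: measurable_itv.
- by rewrite [X in measurable_fun _ X](_ : _ = h)//; apply/funext => -[].
- by apply: (integrable_le_cst _ lebesgue2_itv_lty (M := `|C|)) => //; exact: measurableX.
- by apply: (integrable_le_cst _ itv_fin (M := `|1|)).
- by move=> w z wI zI; rewrite mulr1; exact: hC.
move=> _ E; transitivity (\int[mu]_(z in `[a, b])
    \int[@lebesgue2 R]_(w in `[a, b] `*` `[a, b]) h (w, z)).
  by rewrite E; apply: eq_Rintegral => -[].
apply: eq_Rintegral => z; rewrite inE/= => zI.
have [] := @Rfubini _ _ _ _ _ mu mu `[a, b] `[a, b]
   (fun x y => h (x, y, z)) (cst C) (cst 1).
- exact: measurable_itv.
- exact: measurable_itv.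
- rewrite [X in measurable_fun _ X](_ : _ = fun w => h (w, z)); last by apply/funext => -[].
  exact: (measurableT_comp mh (pair2_measurable z)).
- by apply: (integrable_le_cst _ itv_fin (M := `|C|)).
- by apply: (integrable_le_cst _ itv_fin (M := `|1|)).
- by move=> x y xI yI; rewrite mulr1; exact: hC.
by move=> _ ->; apply: eq_Rintegral => -[].
Qed.

End box.

Section synthesis.
Context {R : realType}.
Notation mu := (@lebesgue_measure R).

(** [m j] counts the quarter-period shifts in direction [j]. A derivative in that direction adds one
    shift and a factor [coord3 j xi], so this family is closed under differentiation. *)
Definition phase (m : nat -> nat) (xi x : R3 R) : R :=
  \prod_(j < 3) tau (m j) (coord3 j xi * coord3 j x).

Lemma phaseE m xi x : phase m xi x =
  tau (m 0%N) (xi.1.1 * x.1.1) * tau (m 1%N) (xi.1.2 * x.1.2) * tau (m 2%N) (xi.2 * x.2).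
Proof. by rewrite /phase !big_ord_recl big_ord0 /= mulr1 mulrA. Qed.

Lemma phase_le1 m xi x : `|phase m xi x| <= 1.
Proof. by rewrite phaseE !normrM !mulr_ile1 ?mulr_ge0 ?tau_le1. Qed.

Lemma continuous_phase m x : continuous (fun xi => phase m xi x).
Proof.
rewrite (_ : (fun xi => phase m xi x) = fun xi => tau (m 0%N) (xi.1.1 * x.1.1) *
    tau (m 1%N) (xi.1.2 * x.1.2) * tau (m 2%N) (xi.2 * x.2)); last first.
  by apply/funext => xi; exact: phaseE.
move=> xi; have ct (i n : nat) (c : R) : tau n (coord3 i z * c) @[z --> xi] --> tau n (coord3 i xi * c).
  apply: (@continuous_comp _ _ _ (fun z : R3 R => coord3 i z * c) (tau n)); last exact: continuous_tau.
  by apply: cvgM; [exact: continuous_coord3|exact: cvg_cst].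
by apply: cvgM; [apply: cvgM; [exact: (ct 0%N)|exact: (ct 1%N)]|exact: (ct 2%N)].
Qed.

Variables (a b : R).
Hypotheses (a0 : 0 < a) (ab : a < b).

Definition synthesis (m : nat -> nat) (g : R3 R -> R) (x : R3 R) : R :=
  \int[lebesgue3 R]_(xi in box a b) (g xi * phase m xi x).

Lemma eq_synthesis m g h : (forall xi, box a b xi -> g xi = h xi) -> synthesis m g = synthesis m h.
Proof.
move=> gh; apply/funext => x; apply: eq_Rintegral => xi; rewrite inE => xib.
by rewrite gh.
Qed.

Lemma continuous_Mphase m (g : R3 R -> R) x :
  continuous g -> continuous (fun xi => g xi * phase m xi x).
Proof. by move=> cg xi; apply: cvgM; [exact: cg|exact: continuous_phase]. Qed.

Lemma integrable_synthesis m (g : R3 R -> R) x : continuous g ->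
  (lebesgue3 R).-integrable (box a b) (EFin \o (fun xi => g xi * phase m xi x)).
Proof. by move=> cg; apply: integrable_box => //; exact: continuous_Mphase. Qed.

Lemma synthesisZ m (g : R3 R -> R) c x : continuous g ->
  synthesis m (fun xi => c * g xi) x = c * synthesis m g x.
Proof.
move=> cg; rewrite -RintegralZl//; last 2 first.
- exact: measurable_box.
- exact: integrable_synthesis.
by apply: eq_Rintegral => xi _; rewrite mulrA.
Qed.

Lemma synthesisD m (g h : R3 R -> R) x : continuous g -> continuous h ->
  synthesis m (fun xi => g xi + h xi) x = synthesis m g x + synthesis m h x.
Proof.
move=> cg ch; rewrite -RintegralD//; last 3 first.
- exact: measurable_box.
- exact: integrable_synthesis.
- exact: integrable_synthesis.
by apply: eq_Rintegral => xi _; rewrite mulrDl.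
Qed.

Lemma synthesis0 m x : synthesis m (fun=> 0) x = 0.
Proof. by rewrite /synthesis /Rintegral integral0_eq// => xi _; rewrite mul0r. Qed.

Lemma synthesis_iter m (g : R3 R -> R) M x : continuous g -> (forall xi, `|g xi| <= M) ->
  synthesis m g x = iter3 a b (m 0%N) (m 1%N) (m 2%N) (fun s t r => g (s, t, r)) x.1.1 x.1.2 x.2.
Proof.
move=> cg gM.
have cu i w : continuous (fun s => g (upd3 i s w)).
  by move=> s; apply: continuous_comp; [exact: continuous_upd3|exact: cg].
pose G s t r := g (s, t, r).
have c1 y z : continuous (fun s => G s y z) by exact: (cu 0%N (0, y, z)).
have c2 y z : continuous (fun s => G y s z) by exact: (cu 1%N (y, 0, z)).
have c3 y z : continuous (fun s => G y z s) by exact: (cu 2%N (y, z, 0)).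
have GM s t r : `|G s t r| <= M by exact: gM.
rewrite /synthesis Rintegral_box//; last exact: continuous_Mphase.
apply: eq_Rintegral => z _.
rewrite -RintegralZr//; last first.
  apply: continuous_integrable_itv; apply: continuous_ftau.
  by apply: (@continuous_iter1y _ a b ab (m 0%N) G M).
apply: eq_Rintegral => y _.
rewrite -mulrA -RintegralZr//; last first.
  by apply: continuous_integrable_itv; apply: continuous_ftau; exact: (c1 y z).
by apply: eq_Rintegral => s _; rewrite phaseE/= !mulrA.
Qed.

(** The retraction of the line onto [[a, b]]: composing with it extends functions from the interval
    continuously, without new values. It serves for the amplitudes and again for the growth rate. *)
Definition clamp (s : R) : R := Num.max a (Num.min s b).

Lemma clamp_itv s : a <= clamp s <= b.
Proof. by rewrite /clamp le_max lexx/= ge_max (ltW ab) ge_min lexx orbT. Qed.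

Lemma clamp_id s : a <= s <= b -> clamp s = s.
Proof. by move=> /andP[sa sb]; rewrite /clamp min_l// max_r. Qed.

Lemma continuous_clamp : continuous clamp.
Proof.
move=> s.
apply: (@continuous_max _ _ (cst a) (fun s => Num.min s b) s); first exact: cvg_cst.
by apply: (@continuous_min _ _ idfun (cst b) s); [exact: cvg_id|exact: cvg_cst].
Qed.

Definition clamp3 (xi : R3 R) : R3 R := (clamp xi.1.1, clamp xi.1.2, clamp xi.2).

Lemma clamp3_id xi : box a b xi -> clamp3 xi = xi.
Proof.
case: xi => -[s t] r /boxP H.
by rewrite /clamp3/= (clamp_id (H 0%N)) (clamp_id (H 1%N)) (clamp_id (H 2%N)).
Qed.

Lemma clamp3_box xi : box a b (clamp3 xi).
Proof. by apply/boxP => -[|[|i]]; exact: clamp_itv. Qed.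

Lemma continuous_clamp3 : continuous clamp3.
Proof.
move=> xi; have cc i : clamp (coord3 i z) @[z --> xi] --> clamp (coord3 i xi).
  by apply: continuous_comp; [exact: continuous_coord3|exact: continuous_clamp].
exact: (cvg_pair (cvg_pair (cc 0%N) (cc 1%N)) (cc 2%N)).
Qed.

Lemma plancherel_synthesis m (g : R3 R -> R) : continuous g ->
  (\int[lebesgue3 R]_x (synthesis m g x ^+ 2)%:E =
   (pi ^+ 3 * \int[lebesgue3 R]_(xi in box a b) g xi ^+ 2)%:E)%E.
Proof.
(* [g] is bounded on the box only; [h] agrees with it there and is bounded everywhere. *)
move=> cg; pose h := g \o clamp3.
have ch : continuous h.
  by move=> xi; apply: continuous_comp; [exact: continuous_clamp3|exact: cg].
have [M [_ gM]] := continuous_box_le a b cg.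
have hM xi : `|h xi| <= M by apply: gM; exact: clamp3_box.
have ghE xi : box a b xi -> g xi = h xi by move=> xib; rewrite /h/= clamp3_id.
have cu i w : continuous (fun s => h (upd3 i s w)).
  by move=> s; apply: (@continuous_comp _ _ _ (fun s => upd3 i s w) h); [exact: continuous_upd3|exact: ch].
rewrite (eq_synthesis m ghE).
under eq_integral do rewrite (synthesis_iter m _ ch hM).
rewrite (@plancherel3 _ _ _ a0 ab (m 0%N) (m 1%N) (m 2%N) (fun s t r => h (s, t, r)) M)//.
- rewrite -(Rintegral_box ab (h := fun xi => h xi ^+ 2)); last first.
    by move=> xi; exact: (cvgM (@ch xi) (@ch xi)).
  by congr (_ * _)%:E; apply: eq_Rintegral => xi; rewrite inE => /ghE ->.
- by move=> y z; exact: (cu 0%N (0, y, z)).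
- by move=> y z; exact: (cu 1%N (y, 0, z)).
- by move=> y z; exact: (cu 2%N (y, z, 0)).
Qed.

End synthesis.

(** * Derivatives of syntheses *)

Section partial_upd3.
Context {R : realType}.

Lemma shift_basis3 (i : 'I_3) (h : R) (x : R3 R) :
  h *: basis3 R i + x = upd3 i (h + coord3 i x) x.
Proof.
case: x => -[x y] z; transitivity ((h * ((i == 0 :> nat)%:R : R) + x,
    h * ((i == 1 :> nat)%:R : R) + y, h * ((i == 2 :> nat)%:R : R) + z) : R3 R) => //.
by case: i => -[|[|[|i]]]//= ilt; rewrite mulr1 !mulr0 !add0r.
Qed.

(** The two difference quotients are equal as functions of the increment, so one-variable calculus
    transfers both existence and value of partial derivatives. *)
Lemma has_partialE (i : 'I_3) (f : R3 R -> R) (x : R3 R) :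
  has_partial i f x = derivable (fun s => f (upd3 i s x)) (coord3 i x) 1.
Proof.
rewrite /has_partial /derivable; set F := (X in X @ _).
set G := (X in _ = cvg (X @ _)); suff -> : F = G by [].
apply/funext => h; rewrite /F /G /=; rewrite shift_basis3 upd3_coord3.
by congr (_ *: (f (upd3 i (_ + _) x) - _)); rewrite /GRing.scale/= mulr1.
Qed.

Lemma partialE (i : 'I_3) (f : R3 R -> R) (x : R3 R) :
  partial i f x = 'D_1 (fun s => f (upd3 i s x)) (coord3 i x).
Proof.
rewrite /partial /derive; set F := (X in lim (X @ _)).
set G := (X in _ = lim (X @ _)); suff -> : F = G by [].
apply/funext => h; rewrite /F /G /=; rewrite shift_basis3 upd3_coord3.
by congr (_ *: (f (upd3 i (_ + _) x) - _)); rewrite /GRing.scale/= mulr1.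
Qed.

Lemma is_derive_upd3 (i : 'I_3) (f : R3 R -> R) (s : R) (x : R3 R) :
  has_partial i f (upd3 i s x) ->
  is_derive s (1 : R) (fun s => f (upd3 i s x)) (partial i f (upd3 i s x)).
Proof.
rewrite has_partialE partialE coord3_upd3_eq.
rewrite (_ : (fun t => f (upd3 i t (upd3 i s x))) = fun t => f (upd3 i t x)).
  by move=> df; apply: DeriveDef.
by apply/funext => t; rewrite upd3_upd3.
Qed.

End partial_upd3.

Section synthesis_derivatives.
Context {R : realType}.
Variables (a b : R).
Hypotheses (a0 : 0 < a) (ab : a < b).
Implicit Types (g : R3 R -> R) (m : nat -> nat).

Definition phase_shift (i : nat) (m : nat -> nat) : nat -> nat :=
  fun j => (m j + (j == i))%N.

(** Two shifts in direction [i] move one cosine by half a period and leave the other two alone. *)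
Lemma synthesisSS (i : 'I_3) m g x : continuous g ->
  synthesis a b (phase_shift i (phase_shift i m)) g x = - synthesis a b m g x.
Proof.
move=> cg; rewrite -mulN1r -synthesisZ//; apply: eq_Rintegral => xi _.
rewrite mulN1r mulNr -mulrN; congr (_ * _).
rewrite /phase (bigD1 i)//= [in RHS](bigD1 i)//= -mulNr.
rewrite /phase_shift eqxx !addn1 tauSS; congr (_ * _).
apply: eq_bigr => j /negbTE ji; rewrite (_ : (j == i :> nat) = false) ?addn0//.
Qed.

Lemma is_derive_synthesis (i : 'I_3) m g (x : R3 R) (s : R) : continuous g ->
  is_derive s (1 : R) (fun s => synthesis a b m g (upd3 i s x))
    (synthesis a b (phase_shift i m) (fun xi => coord3 i xi * g xi) (upd3 i s x)).
Proof.
move=> cg.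
have phaseD n (xi : R3 R) (t : R) : phase n xi (upd3 i t x) = tau (n i) (coord3 i xi * t) *
    \prod_(j < 3 | j != i) tau (n j) (coord3 j xi * coord3 j x).
  rewrite /phase (bigD1 i)//= coord3_upd3_eq; congr (_ * _).
  by apply: eq_bigr => j ji; rewrite coord3_upd3_neq.
have [C [C0 gC]] := continuous_box_le a b cg.
have cig : continuous (fun xi : R3 R => coord3 i xi * g xi).
  by move=> xi; apply: cvgM; [exact: continuous_coord3|exact: cg].
have [C' [C'0 gC']] := continuous_box_le a b cig.
apply: (@is_derive_Rintegral_le_cst _ _ _ (lebesgue3 R) (box a b) (measurable_box a b)
  (lebesgue3_box_fin ab)
  (fun s xi => g xi * phase m xi (upd3 i s x))
  (fun s xi => (coord3 i xi * g xi) * phase (phase_shift i m) xi (upd3 i s x)) C C').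
- move=> t; apply: measurable_funTS; apply: measurable_continuous3.
  exact: continuous_Mphase.
- move=> t xi xib _; rewrite normrM (le_trans _ (gC xi xib))//.
  by rewrite ler_piMr// phase_le1.
- move=> t xi _.
  under eq_fun do rewrite phaseD mulrCA.
  rewrite phaseD.
  have -> : \prod_(j < 3 | j != i) tau (phase_shift i m j) (coord3 j xi * coord3 j x) =
      \prod_(j < 3 | j != i) tau (m j) (coord3 j xi * coord3 j x).
    apply: eq_bigr => j /negbTE ji; rewrite /phase_shift (_ : (j == i :> nat) = false) ?addn0//.
  move: (\prod_(j < 3 | _) _) => c.
  have dt := is_derive_tau (m i) (coord3 i xi) t.
  apply: is_derive_eq.
  by rewrite /phase_shift eqxx addn1 /GRing.scale/=; ring.
- move=> t xi xib _; rewrite normrM (le_trans _ (gC' xi xib))//.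
  by rewrite ler_piMr// phase_le1.
Qed.

Lemma has_partial_synthesis (i : 'I_3) m g x : continuous g ->
  has_partial i (synthesis a b m g) x.
Proof. by move=> cg; rewrite has_partialE; have [] := is_derive_synthesis i m x (coord3 i x) cg. Qed.

Lemma partial_synthesis (i : 'I_3) m g : continuous g ->
  partial i (synthesis a b m g) = synthesis a b (phase_shift i m) (fun xi => coord3 i xi * g xi).
Proof.
move=> cg; apply/funext => x; rewrite partialE.
have [_ ->] := is_derive_synthesis i m x (coord3 i x) cg.
by rewrite upd3_coord3.
Qed.

Lemma continuous_synthesis_upd3 (i : 'I_3) m g x : continuous g ->
  continuous (fun s => synthesis a b m g (upd3 i s x)).
Proof.
move=> cg s; apply: differentiable_continuous; apply/derivable1_diffP.
by have [] := is_derive_synthesis i m x s cg.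
Qed.

Lemma measurable_synthesis m g : continuous g ->
  measurable_fun [set: mR3 R] (synthesis a b m g : mR3 R -> R).
Proof.
move=> cg; apply: measurable_continuous_upd3 => -[|[|i]] x.
- exact: (continuous_synthesis_upd3 (i := 0)).
- exact: (continuous_synthesis_upd3 (i := 1)).
- exact: (continuous_synthesis_upd3 (i := 2)).
Qed.

Lemma synthesis_le m g : continuous g -> exists C, 0 <= C /\ forall x, `|synthesis a b m g x| <= C.
Proof.
move=> cg; have [C [C0 gC]] := continuous_box_le a b cg.
exists (C * fine (lebesgue3 R (box a b))); split.
  by rewrite mulr_ge0// fine_ge0.
move=> x; apply: normr_Rintegral_le.
- exact: measurable_box.
- exact: lebesgue3_box_fin.
- by apply: measurable_funTS; apply: measurable_continuous3; exact: continuous_Mphase.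
- move=> xi xib; rewrite normrM (le_trans _ (gC xi xib))//.
  by rewrite ler_piMr// phase_le1.
Qed.

Lemma is_derive_synthesis_time m g (l : R3 R -> R) (x : R3 R) (t : R) :
  continuous g -> continuous l ->
  is_derive t (1 : R) (fun t => synthesis a b m (fun xi => g xi * expR (t * l xi)) x)
    (synthesis a b m (fun xi => l xi * (g xi * expR (t * l xi))) x).
Proof.
move=> cg cl.
have cge (s : R) : continuous (fun xi => g xi * expR (s * l xi)).
  move=> xi; apply: cvgM; first exact: cg.
  apply: (@continuous_comp _ _ _ (fun xi => s * l xi) expR); last exact: continuous_expR.
  by apply: cvgM; [exact: cvg_cst|exact: cl].
have [C [C0 gC]] := continuous_box_le a b cg.
have [L [L0 lL]] := continuous_box_le a b cl.
(* Times within distance 1 of [t] have absolute value at most [|t| + 1], and [L] bounds the rate on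
   the box. *)
have gexp (s : R) xi : box a b xi -> `|s - t| < 1 ->
    `|g xi * expR (s * l xi)| <= C * expR ((`|t| + 1) * L).
  move=> xib st; rewrite normrM ler_pM ?gC// ger0_norm ?expR_ge0// ler_expR.
  rewrite (le_trans (ler_norm _))// normrM ler_pM ?lL//.
  by rewrite -(subrK t s) addrC (le_trans (ler_normD _ _))// lerD2l ltW.
apply: (@is_derive_Rintegral_le_cst _ _ _ (lebesgue3 R) (box a b) (measurable_box a b)
  (lebesgue3_box_fin ab)
  (fun s xi => g xi * expR (s * l xi) * phase m xi x)
  (fun s xi => l xi * (g xi * expR (s * l xi)) * phase m xi x)
  (C * expR ((`|t| + 1) * L)) (L * (C * expR ((`|t| + 1) * L)))).
- move=> s; apply: measurable_funTS; apply: measurable_continuous3.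
  exact: continuous_Mphase.
- move=> s xi xib st; rewrite normrM (le_trans _ (gexp s xi xib st))//.
  by rewrite ler_piMr// phase_le1.
- move=> s xi _; apply: is_derive_eq.
  by rewrite /GRing.scale/=; ring.
- move=> s xi xib st; rewrite normrM.
  apply: (@le_trans _ _ (`|l xi * (g xi * expR (s * l xi))|)).
    by rewrite ler_piMr// phase_le1.
  by rewrite normrM ler_pM ?lL ?gexp.
Qed.

End synthesis_derivatives.

(** * Sobolev regularity *)

Section L2.
Context {R : realType}.

Lemma L2norm_sqrt (f : R3 R -> R) (J : R) : 0 <= J ->
  (\int[lebesgue3 R]_x (f x ^+ 2)%:E = J%:E)%E -> L2norm f = (Num.sqrt J)%:E.
Proof.
move=> J0 fJ; rewrite /L2norm unlock /=.
rewrite (_ : (\int[_]_x _)%E = J%:E).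
  by rewrite poweR_EFin powR12_sqrt.
rewrite -fJ; apply: eq_integral => x _ /=.
by rewrite powR_mulrn// real_normK// num_real.
Qed.

Variables (a b : R).
Hypotheses (a0 : 0 < a) (ab : a < b).

Lemma L2norm_synthesis m (g : R3 R -> R) : continuous g ->
  L2norm (synthesis a b m g) =
  (Num.sqrt (pi ^+ 3 * \int[lebesgue3 R]_(xi in box a b) g xi ^+ 2))%:E.
Proof.
move=> cg; apply: L2norm_sqrt; last exact: plancherel_synthesis.
rewrite mulr_ge0 ?exprn_ge0 ?pi_ge0//.
by apply: Rintegral_ge0 => xi _; exact: sqr_ge0.
Qed.

Lemma in_L2_synthesis m (g : R3 R -> R) : continuous g -> in_L2 (synthesis a b m g).
Proof.
move=> cg; rewrite /in_L2 inE; apply/andP; split; rewrite inE/=.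
  exact: measurable_synthesis.
by rewrite /finite_norm -/(L2norm (synthesis a b m g)) L2norm_synthesis// ltry.
Qed.

Lemma L2norm_synthesis_le m (g : R3 R -> R) (C : R) : continuous g -> 0 <= C ->
  (forall xi, box a b xi -> `|g xi| <= C) ->
  (L2norm (synthesis a b m g) <= (C * Num.sqrt (pi ^+ 3 * (b - a) ^+ 3))%:E)%E.
Proof.
move=> cg C0 gC; rewrite L2norm_synthesis// lee_fin.
rewrite (_ : C * _ = Num.sqrt (C ^+ 2 * (pi ^+ 3 * (b - a) ^+ 3))); last first.
  by rewrite [RHS]sqrtrM ?sqr_ge0// sqrtr_sqr ger0_norm.
rewrite ler_wsqrtr//.
rewrite mulrCA ler_wpM2l ?exprn_ge0 ?pi_ge0//.
have -> : (b - a) ^+ 3 = fine (lebesgue3 R (box a b)) by rewrite lebesgue3_boxE.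
have cg2 : continuous (fun xi => g xi ^+ 2) by move=> xi; exact: (cvgM (@cg xi) (@cg xi)).
rewrite -Rintegral_cst//; last exact: measurable_box.
apply: le_Rintegral.
- exact: measurable_box.
- exact: integrable_box.
- by apply: integrable_box => // xi; exact: cvg_cst.
- move=> xi xib; rewrite -(real_normK (num_real (g xi))) lerXn2r ?nnegrE//.
  exact: gC.
Qed.

End L2.

(** * Integration by parts against test functions *)

Section integration_by_parts.
Context {R : realType}.
Notation mu := (@lebesgue_measure R).

(** Compact support is replaced by an explicit cube, so that all derivatives of a test function
    share the same [N]. *)
Definition bump_function (N : R) (chi : R3 R -> R) : Prop :=
  smooth3 chi /\ forall x (i : 'I_3), N < `|coord3 i x| -> chi x = 0.

Lemma coord3_le_norm (i : nat) (x : R3 R) : `|coord3 i x| <= `|x|.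
Proof.
case: i => [|[|i]] /=; rewrite [leRHS]prod_normE le_max ?lexx ?orbT//;
by rewrite prod_normE le_max lexx ?orbT.
Qed.

Lemma test_bump_function (psi : R3 R -> R) : test_function psi ->
  exists2 N, 0 < N & bump_function N psi.
Proof.
move=> [ss /compact_bounded[M [Mr sM]]].
exists (`|M| + 1); [by rewrite ltr_wpDl|split => //].
move=> x i Nx; apply/eqP; apply: contraPT Nx => px; apply/negP; rewrite -leNgt.
apply: (le_trans (coord3_le_norm i x)).
apply: (sM (`|M| + 1)); first by rewrite (le_lt_trans (ler_norm M))// ltrDl.
by apply: subset_closure.
Qed.

(** The condition [N < |coord3 i x|] is open, so [chi] is zero near [x] along direction [j] and its
    derivative there is that of 0. *)
Lemma bump_function_partial (j : 'I_3) N chi :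
  bump_function N chi -> bump_function N (partial j chi).
Proof.
move=> [sc cN]; split.
  (* [foldr] applies the last index of a list first, so the derivatives [s] of [partial j chi] are
     those of [chi] along [rcons s j]. *)
  by move=> s; have := sc (rcons s j); rewrite foldr_rcons.
move=> x i Nx; rewrite partialE.
rewrite (@near_eq_derive _ _ _ _ (cst 0)); first exact: derive_cst.
have [->|ij] := eqVneq j i.
  near=> s; rewrite (cN _ i)// coord3_upd3_eq.
  near: s.
  have /cvgr_gt := @norm_continuous _ R (coord3 i x).
  by apply.
by near=> s; rewrite (cN _ i)// coord3_upd3_neq// eq_sym.
Unshelve. all: by end_near. Qed.

Lemma bump_function_iter (j : 'I_3) n N chi :
  bump_function N chi -> bump_function N (iter n (partial j) chi).
Proof. by move=> tc; elim: n => //= n IH; exact: bump_function_partial. Qed.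

End integration_by_parts.

Section box_slices.
Context {R : realType}.
Notation mu := (@lebesgue_measure R).
Variables (a b : R).
Hypothesis (ab : a < b).

Let itv_fin := lebesgue_measure_itv_lty ab.

Let itv2_fin := lebesgue2_itv_lty ab.

(** By Fubini the order of integration can be chosen so that direction [i] comes innermost, for each
    of the three directions. *)
Lemma Rintegral_box_slices0 (i : 'I_3) (h : R3 R -> R) (C : R) :
  measurable_fun [set: mR3 R] (h : mR3 R -> R) -> (forall x, `|h x| <= C) ->
  (forall x, \int[mu]_(s in `[a, b]) h (upd3 i s x) = 0) ->
  \int[lebesgue3 R]_(x in box a b) h x = 0.
Proof.
move=> mh hC hi0.
have int0 d (T : measurableType d) (nu : {measure set T -> \bar R}) (D : set T) (f : T -> R) :
    (forall t, f t = 0) -> \int[nu]_(t in D) f t = 0.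
  by move=> f0; rewrite /Rintegral integral0_eq// => t _; rewrite f0.
have [] := @Rfubini _ _ _ _ _ (@lebesgue2 R) mu (`[a, b] `*` `[a, b]) `[a, b]
   (fun w z => h (w, z)) (cst C) (cst 1).
- exact: measurableX.
- exact: measurable_itv.
- by rewrite [X in measurable_fun _ X](_ : _ = h)//; apply/funext => -[].
- by apply: (integrable_le_cst _ itv2_fin (M := `|C|)) => //; exact: measurableX.
- by apply: (integrable_le_cst _ itv_fin (M := `|1|)).
- by move=> w z wI zI; rewrite mulr1; exact: hC.
move=> E1 E2.
have E0 : \int[lebesgue3 R]_(x in box a b) h x =
    \int[(lebesgue2 \x mu)%E]_(z in `[a, b] `*` `[a, b] `*` `[a, b]) h (z.1, z.2).
  by apply: eq_Rintegral => -[].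
have F z : \int[mu]_(x in `[a, b]) \int[mu]_(y in `[a, b]) h (x, y, z) =
      \int[@lebesgue2 R]_(w in `[a, b] `*` `[a, b]) h (w, z) /\
    \int[mu]_(y in `[a, b]) \int[mu]_(x in `[a, b]) h (x, y, z) =
      \int[@lebesgue2 R]_(w in `[a, b] `*` `[a, b]) h (w, z).
  have [] := @Rfubini _ _ _ _ _ mu mu `[a, b] `[a, b]
     (fun x y => h (x, y, z)) (cst C) (cst 1).
  - exact: measurable_itv.
  - exact: measurable_itv.
  - rewrite [X in measurable_fun _ X](_ : _ = fun w => h (w, z)); last by apply/funext => -[].
    exact: (measurableT_comp mh (pair2_measurable z)).
  - by apply: (integrable_le_cst _ itv_fin (M := `|C|)).
  - by apply: (integrable_le_cst _ itv_fin (M := `|1|)).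
  - by move=> x y xI yI; rewrite mulr1; exact: hC.
  by move=> -> ->; split; apply: eq_Rintegral => -[].
rewrite E0; case: i hi0 => -[|[|[|i]]]//= ilt hi0.
- rewrite -E2; apply: (@int0) => z; have [_ <-] := F z; apply: (@int0) => y.
  exact: (hi0 (0, y, z)).
- rewrite -E2; apply: (@int0) => z; have [<- _] := F z; apply: (@int0) => x.
  exact: (hi0 (x, 0, z)).
- rewrite -E1; apply: (@int0) => w; exact: (hi0 (w, 0)).
Qed.

End box_slices.

Section integration_by_parts.
Context {R : realType}.
Notation mu := (@lebesgue_measure R).

Lemma bump_function_le N (chi : R3 R -> R) : bump_function N chi ->
  exists C, 0 <= C /\ forall x, `|chi x| <= C.
Proof.
move=> [sc cN].
have [cc _] := sc [::]; have [C [C0 cC]] := continuous_box_le (- N) N cc.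
exists C; split => // x; have [xb|] := pselect (box (- N) N x); first exact: cC.
move=> /boxP/existsNP[i]; rewrite -ler_norml => /negP; rewrite -ltNge => Ni.
suff -> : chi x = 0 by rewrite normr0.
case: i Ni => [|[|i]] Ni.
- exact: (cN x 0).
- exact: (cN x 1).
- exact: (cN x 2).
Qed.

(** The sum of the two integrands is the derivative of [f * chi] in direction [i]. Its integral over
    a segment is the difference of end values, both zero because [chi] vanishes there. *)
Lemma Rintegral_partial_bump (i : 'I_3) (f chi : R3 R -> R) (N0 C : R) :
  0 < N0 -> bump_function N0 chi ->
  (forall x, has_partial i f x) ->
  (forall j x, continuous (fun s => f (upd3 j s x))) ->
  (forall j x, continuous (fun s => partial i f (upd3 j s x))) ->
  (forall x, `|f x| <= C) -> (forall x, `|partial i f x| <= C) ->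
  \int[lebesgue3 R]_x (f x * partial i chi x) =
  - \int[lebesgue3 R]_x (partial i f x * chi x).
Proof.
move=> N00 tc df cf cdf fC dfC.
have tdc := bump_function_partial i tc.
have [K [K0 cK]] := bump_function_le tc.
have [K' [K'0 dcK]] := bump_function_le tdc.
have [sc cN0] := tc; have [_ dcN0] := tdc.
have [cc _] := sc [::]; have [cdc hpc] := sc [:: i].
have hpc0 := (sc [::]).2 i.
(* The enlargement puts the faces of the cube strictly beyond [N0], where [chi] and its derivative
   are known to vanish. *)
pose N := N0 + 1.
have N_gt0 : 0 < N by rewrite addr_gt0.
have NN : - N < N by rewrite gtrN.
have bN0 (h : R3 R -> R) : (forall x (i : 'I_3), N0 < `|coord3 i x| -> h x = 0) ->
    forall x, ~ box (- N) N x -> h x = 0.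
  move=> hN x /boxP/existsNP[j]; rewrite -ler_norml => /negP; rewrite -ltNge => Nj.
  have {}Nj : N0 < `|coord3 j x| by rewrite (lt_trans _ Nj)// ltrDl.
  case: j Nj => [|[|j]] Nj.
  - exact: (hN x 0).
  - exact: (hN x 1).
  - exact: (hN x 2).
have cu (h : R3 R -> R) j x : continuous h -> continuous (fun s => h (upd3 j s x)).
  move=> ch s; apply: (@continuous_comp _ _ _ (fun s => upd3 j s x) h); last exact: ch.
  exact: continuous_upd3.
have m1 : measurable_fun [set: mR3 R] (fun x => f x * partial i chi x).
  apply: measurable_continuous_upd3 => j x s.
  by apply: cvgM; [exact: cf|exact: cu].
have m2 : measurable_fun [set: mR3 R] (fun x => partial i f x * chi x).
  apply: measurable_continuous_upd3 => j x s.
  by apply: cvgM; [exact: cdf|exact: cu].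
have C0 : 0 <= C := le_trans (normr_ge0 _) (fC (0, 0, 0)).
have b1 x : `|f x * partial i chi x| <= C * K' by rewrite normrM ler_pM.
have b2 x : `|partial i f x * chi x| <= C * K by rewrite normrM ler_pM.
have to_box (h : R3 R -> R) : (forall x, ~ box (- N) N x -> h x = 0) ->
    \int[lebesgue3 R]_x h x = \int[lebesgue3 R]_(x in box (- N) N) h x.
  move=> h0; rewrite [RHS]Rintegral_mkcond; apply: eq_Rintegral => x _.
  by rewrite patchE; case: ifPn => // /negP; rewrite inE => /h0.
rewrite !to_box; last 2 first.
- by move=> x /(bN0 _ cN0) ->; rewrite mulr0.
- by move=> x /(bN0 _ dcN0) ->; rewrite mulr0.
apply/eqP; rewrite -subr_eq0 opprK -RintegralD; last 3 first.
- exact: measurable_box.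
- by apply: (integrable_le_cst _ (lebesgue3_box_fin NN) _ (fun x _ => b1 x));
    [exact: measurable_box|exact: measurable_funTS].
- by apply: (integrable_le_cst _ (lebesgue3_box_fin NN) _ (fun x _ => b2 x));
    [exact: measurable_box|exact: measurable_funTS].
apply/eqP; apply: (@Rintegral_box_slices0 _ _ _ NN i
  (fun x => f x * partial i chi x + partial i f x * chi x) (C * K' + C * K)).
- exact: measurable_funD.
- by move=> x; rewrite (le_trans (ler_normD _ _))// lerD.
move=> x; pose F s := f (upd3 i s x) * chi (upd3 i s x).
have dF (s : R) : is_derive s (1 : R) F (f (upd3 i s x) * partial i chi (upd3 i s x) +
    partial i f (upd3 i s x) * chi (upd3 i s x)).
  have df1 := is_derive_upd3 (df (upd3 i s x)).
  have dc1 := is_derive_upd3 (hpc0 (upd3 i s x)).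
  apply: is_derive_eq.
  by rewrite /GRing.scale/= [_ * partial i f _]mulrC.
have cF : continuous F.
  by move=> s; apply: differentiable_continuous; apply/derivable1_diffP; have [] := dF s.
rewrite /Rintegral (@continuous_FTC2 _ _ F)//=.
- rewrite /F (cN0 _ i) ?coord3_upd3_eq ?(cN0 (upd3 i (- N) x) i) ?coord3_upd3_eq ?mulr0 ?subrr//.
    by rewrite normrN gtr0_norm// ltrDl.
  by rewrite gtr0_norm// ltrDl.
- apply: continuous_subspaceT => s; apply: cvgD; apply: cvgM.
  + exact: cf.
  + exact: cu.
  + exact: cdf.
  + exact: cu.
- split; first by move=> t _; have [] := dF t.
    by apply: cvg_at_right_filter; exact: cF.
  by apply: cvg_at_left_filter; exact: cF.
- by move=> t _; rewrite derive1E; have [_ ->] := dF t.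
Qed.

End integration_by_parts.

Section weak_derivatives.
Context {R : realType}.
Variables (a b : R).
Hypotheses (a0 : 0 < a) (ab : a < b).
Implicit Types (g : R3 R -> R) (m : nat -> nat).

Lemma Rintegral_iter_partial (i : 'I_3) n m g N chi : continuous g -> 0 < N ->
  bump_function N chi ->
  \int[lebesgue3 R]_x (synthesis a b m g x * iter n (partial i) chi x) =
  (-1) ^+ n * \int[lebesgue3 R]_x
    (synthesis a b (iter n (phase_shift i) m) (fun xi => coord3 i xi ^+ n * g xi) x * chi x).
Proof.
move=> + N0 tc; elim: n m g => [|n IH] m g cg.
  rewrite mul1r; apply: eq_Rintegral => x _ /=; congr (_ * _).
  by congr synthesis; apply/funext => xi; rewrite mul1r.
have cig : continuous (fun xi : R3 R => coord3 i xi * g xi).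
  by move=> xi; apply: cvgM; [exact: continuous_coord3|exact: cg].
have [C1 [C10 fC1]] := synthesis_le ab m cg.
have [C2 [C20 fC2]] := synthesis_le ab (phase_shift i m) cig.
rewrite /= (@Rintegral_partial_bump _ _ _ _ N (C1 + C2))//.
- rewrite partial_synthesis// IH// -iterS iterSr exprS mulN1r mulNr.
  apply: (congr1 (fun z => - ((-1) ^+ n * z))).
  apply: eq_Rintegral => x _; congr (_ * _); congr synthesis.
  by apply/funext => xi; rewrite exprSr mulrA.
- exact: bump_function_iter.
- by move=> x; exact: has_partial_synthesis.
- move=> [|[|j]] x.
  + exact: (continuous_synthesis_upd3 ab (i := 0)).
  + exact: (continuous_synthesis_upd3 ab (i := 1)).
  + exact: (continuous_synthesis_upd3 ab (i := 2)).
- move=> [|[|j]] x; rewrite partial_synthesis//.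
  + exact: (continuous_synthesis_upd3 ab (i := 0)).
  + exact: (continuous_synthesis_upd3 ab (i := 1)).
  + exact: (continuous_synthesis_upd3 ab (i := 2)).
- by move=> x; rewrite (le_trans (fC1 x))// lerDl.
- by move=> x; rewrite partial_synthesis// (le_trans (fC2 x))// lerDr.
Qed.

(** Integration by parts removes the outermost derivative of the test function first, that is the
    head of the list; hence a left fold against the right fold of [partial_mi]. *)
Definition phase_shifts (al : 'I_3 -> nat) (l : seq 'I_3) m : nat -> nat :=
  foldl (fun m i => iter (al i) (phase_shift i) m) m l.

Definition monomial (al : 'I_3 -> nat) (l : seq 'I_3) (xi : R3 R) : R :=
  \prod_(i <- l) coord3 i xi ^+ al i.

Lemma continuous_monomial al l : continuous (monomial al l).
Proof.
elim: l => [|i l IH] xi.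
  rewrite (_ : monomial al [::] = cst 1); first exact: cvg_cst.
  by apply/funext => z; rewrite /monomial big_nil.
rewrite (_ : monomial al (i :: l) = fun xi => coord3 i xi ^+ al i * monomial al l xi).
  apply: cvgM; last exact: IH.
  apply: (@continuous_comp _ _ _ (coord3 i) (fun z => z ^+ al i)).
    exact: continuous_coord3.
  exact: exprn_continuous.
by apply/funext => z; rewrite /monomial big_cons.
Qed.

Lemma continuous_monomialM al l g : continuous g ->
  continuous (fun xi => monomial al l xi * g xi).
Proof. by move=> cg xi; apply: cvgM; [exact: continuous_monomial|exact: cg]. Qed.

Lemma bump_function_foldr (al : 'I_3 -> nat) (l : seq 'I_3) N (chi : R3 R -> R) :
  bump_function N chi ->
  bump_function N (foldr (fun i => iter (al i) (partial i)) chi l).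
Proof. by move=> tc; elim: l => //= i l IH; exact: bump_function_iter. Qed.

Lemma Rintegral_foldr_partial (al : 'I_3 -> nat) (l : seq 'I_3) m g N chi :
  continuous g -> 0 < N -> bump_function N chi ->
  \int[lebesgue3 R]_x
    (synthesis a b m g x * foldr (fun i => iter (al i) (partial i)) chi l x) =
  (-1) ^+ (\sum_(i <- l) al i)%N * \int[lebesgue3 R]_x
    (synthesis a b (phase_shifts al l m) (fun xi => monomial al l xi * g xi) x * chi x).
Proof.
move=> + N0 tc; elim: l m g => [|i l IH] m g cg.
  rewrite big_nil mul1r; apply: eq_Rintegral => x _ /=; congr (_ * _).
  by congr synthesis; apply/funext => xi; rewrite /monomial big_nil mul1r.
rewrite /= (Rintegral_iter_partial i (al i) m cg N0); last exact: bump_function_foldr.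
rewrite IH; last first.
  move=> xi; apply: cvgM; last exact: cg.
  apply: (@continuous_comp _ _ _ (coord3 i) (fun z => z ^+ al i)).
    exact: continuous_coord3.
  exact: exprn_continuous.
rewrite mulrA -exprD big_cons.
apply: (congr1 (GRing.mul ((-1) ^+ (al i + \sum_(j <- l) al j)%N))).
apply: eq_Rintegral => x _.
congr (_ * _); congr synthesis; apply/funext => xi.
by rewrite /monomial big_cons mulrA [_ ^+ _ * _]mulrC.
Qed.

Lemma weak_jet_synthesis k m g : continuous g ->
  @weak_jet R k (synthesis a b m g) (fun al => synthesis a b (phase_shifts (fun i => al i) (enum 'I_3) m)
    (fun xi => monomial (fun i => al i) (enum 'I_3) xi * g xi)).
Proof.
move=> cg al _; split.
  by apply: in_L2_synthesis => //; exact: continuous_monomialM.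
move=> psi /test_bump_function[N N0 tpsi].
rewrite /partial_mi (@Rintegral_foldr_partial (fun i => al i) _ _ _ N)//.
by rewrite /order_mi big_enum.
Qed.

Lemma in_H_synthesis k m g : continuous g -> in_H k (synthesis a b m g).
Proof.
by move=> cg; split; [exact: in_L2_synthesis|eexists; exact: weak_jet_synthesis].
Qed.

(** [Hnorm] is an infimum over jets, so the explicit jet of [weak_jet_synthesis] suffices. [K]
    gathers bounds of the monomials on the box and is chosen before the amplitude. *)
Lemma Hnorm_synthesis_le k m : exists2 K : R, 0 <= K &
  forall g C, continuous g -> 0 <= C -> (forall xi, box a b xi -> `|g xi| <= C) ->
  (Hnorm k (synthesis a b m g) <= (C * K)%:E)%E.
Proof.
have /choice[B HB] : forall al : {ffun 'I_3 -> 'I_k.+1}, exists B : R, 0 <= B /\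
    forall xi, box a b xi -> `|monomial (fun i => al i) (enum 'I_3) xi| <= B.
  by move=> al; apply: continuous_box_le; exact: continuous_monomial.
pose S := Num.sqrt (pi ^+ 3 * (b - a) ^+ 3).
pose T := \sum_(al : {ffun 'I_3 -> 'I_k.+1} | (order_mi al <= k)%N) (B al * S) ^+ 2.
have T0 : 0 <= T by apply: sumr_ge0 => al _; exact: sqr_ge0.
exists (Num.sqrt T); first exact: sqrtr_ge0.
move=> g C cg C0 gC.
apply: le_trans; first apply: ereal_inf_lbound.
  by exists (fun al : {ffun 'I_3 -> 'I_k.+1} =>
    synthesis a b (phase_shifts (fun i => al i) (enum 'I_3) m)
      (fun xi => monomial (fun i => al i) (enum 'I_3) xi * g xi)); [exact: weak_jet_synthesis|].
apply: (@le_trans _ _ (((C ^+ 2 * T)%:E `^ 2^-1)%E)); last first.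
  by rewrite poweR_EFin powR12_sqrt ?mulr_ge0 ?sqr_ge0// sqrtrM ?sqr_ge0// sqrtr_sqr ger0_norm.
apply: gt0_ler_poweR; rewrite ?in_itv/= ?leey ?andbT//.
- by apply: sume_ge0 => al _; rewrite -expe2 sqre_ge0.
- by rewrite lee_fin mulr_ge0// sqr_ge0.
rewrite mulr_sumr -sumEFin; apply: lee_sum => al _.
have [B0 monoB] := HB al.
have cmg : continuous (fun xi => monomial (fun i => al i) (enum 'I_3) xi * g xi).
  exact: continuous_monomialM.
have BC0 : 0 <= B al * C by rewrite mulr_ge0.
have BC xi : box a b xi ->
    `|monomial (fun i => al i) (enum 'I_3) xi * g xi| <= B al * C.
  by move=> xib; rewrite normrM ler_pM ?monoB ?gC.
have := L2norm_synthesis_le a0 ab (phase_shifts (fun i => al i) (enum 'I_3) m) cmg BC0 BC.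
rewrite L2norm_synthesis// -EFinM !lee_fin => le1.
rewrite -exprMn (_ : C * (B al * S) = B al * C * S); last by ring.
by rewrite expr2 ler_pM ?sqrtr_ge0.
Qed.

(** For negative [y] compare through the tangent at 0: [1 - expR y <= - y <= expR (- y) - 1]. *)
Lemma norm_expRB1 (y : R) : `|expR y - 1| <= expR `|y| - 1.
Proof.
have [y0|y0] := leP 0 y.
  by rewrite ger0_norm ?ger0_norm// subr_ge0 -expR0 ler_expR.
rewrite ler0_norm; last by rewrite subr_le0 -[leRHS]expR0 ler_expR ltW.
rewrite (ltr0_norm y0).
by have := expR_ge1Dx y; have := expR_ge1Dx (- y); lra.
Qed.

(** The difference between times [s] and [t] is a synthesis whose amplitude has the factor
    [expR ((s - t) * l xi) - 1], uniformly small on the box as [s] tends to [t]. *)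
Lemma continuous_into_H_synthesis k m g (l : R3 R -> R) : continuous g -> continuous l ->
  continuous_into_H k (fun t => synthesis a b m (fun xi => g xi * expR (t * l xi))).
Proof.
move=> cg cl.
have cge (s : R) : continuous (fun xi => g xi * expR (s * l xi)).
  move=> xi; apply: cvgM; first exact: cg.
  apply: (@continuous_comp _ _ _ (fun xi => s * l xi) expR); last exact: continuous_expR.
  by apply: cvgM; [exact: cvg_cst|exact: cl].
split=> [t t0|t t0]; first exact: in_H_synthesis.
have [K K0 HK] := Hnorm_synthesis_le k m.
have [C [C0 gC]] := continuous_box_le a b (cge t).
have [L [L0 lL]] := continuous_box_le a b cl.
pose de (s : R) : R := C * (expR (`|s - t| * L) - 1).
have de0 s : 0 <= de s.
  by rewrite mulr_ge0// subr_ge0 -expR0 ler_expR mulr_ge0.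
have cde : (de s * K)%:E @[s --> within `[0, +oo[ (nbhs t)] --> 0%E.
  have -> : 0%E = (de t * K)%:E :> \bar R.
    by rewrite /de subrr normr0 mul0r expR0 subrr mulr0 mul0r.
  apply: cvg_within_filter; apply: cvg_EFin; first exact: nearW.
  apply: cvgM; last exact: cvg_cst.
  apply: cvgM; first exact: cvg_cst.
  apply: cvgB; last exact: cvg_cst.
  apply: (@continuous_comp _ _ _ (fun s => `|s - t| * L) expR); last exact: continuous_expR.
  apply: cvgM; last exact: cvg_cst.
  by apply: cvg_norm; apply: cvgB; [exact: cvg_id|exact: cvg_cst].
apply: (squeeze_cvge _ (cvg_cst 0%E) cde); apply: nearW => s; apply/andP; split.
  by apply: le_ereal_inf_tmp => _ [G _ <-]; exact: poweR_ge0.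
rewrite (_ : (_ \- _) = synthesis a b m (fun xi => g xi * expR (t * l xi) * (expR ((s - t) * l xi) - 1))).
  apply: HK => //.
  - move=> xi; apply: cvgM; first exact: cge.
    apply: cvgB; last exact: cvg_cst.
    apply: (@continuous_comp _ _ _ (fun xi => (s - t) * l xi) expR); last exact: continuous_expR.
    by apply: cvgM; [exact: cvg_cst|exact: cl].
  - move=> xi xib; rewrite normrM ler_pM ?gC//.
    rewrite (le_trans (norm_expRB1 _))// lerD2r ler_expR normrM ler_wpM2l// lL//.
apply/funext => x /=; rewrite -[X in _ - X]mul1r -mulNr -synthesisZ// -synthesisD//; last first.
  by move=> xi; apply: cvgM; [exact: cvg_cst|exact: cge].
congr (synthesis _ _ _ _ _); apply/funext => xi.
rewrite (_ : s * l xi = t * l xi + (s - t) * l xi); last by ring.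
by rewrite expRD; ring.
Qed.

End weak_derivatives.

(** * Growth rates *)

Section dispersion.
Context {R : realType}.
Variables (al be mu nu ga rb A : R).
Hypotheses (al0 : 0 < al) (be0 : 0 < be) (mu0 : 0 < mu) (nu0 : 0 < nu)
  (ga0 : 0 < ga) (rb0 : 0 < rb) (A0 : 0 < A) (unstable : nu * A < be * ga).

(* The cubic in the rate [l] for waves of squared frequency [k], where [A]
   stands for [P' rhobar / rhobar]. *)
Definition dispersion (l k : R) : R :=
  (l ^+ 2 + al * l + rb * A * k) * (l + mu * k + nu) - rb * be * ga * k.

(** After division by [l1 - l2] every term other than [al * nu] is nonnegative. The explicit slope
    turns a small value of the cubic into a small distance to its root, which gives continuity of
    the root in [k]. *)
Lemma dispersion_increasing (k l1 l2 : R) : 0 <= k -> 0 <= l2 -> l2 <= l1 ->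
  al * nu * (l1 - l2) <= dispersion l1 k - dispersion l2 k.
Proof.
move=> k0 l20 l12; have l10 := le_trans l20 l12.
have d0 : 0 <= l1 - l2 by rewrite subr_ge0.
rewrite -subr_ge0 /dispersion.
have -> : (l1 ^+ 2 + al * l1 + rb * A * k) * (l1 + mu * k + nu) - rb * be * ga * k -
    ((l2 ^+ 2 + al * l2 + rb * A * k) * (l2 + mu * k + nu) - rb * be * ga * k) -
    al * nu * (l1 - l2) =
  (l1 - l2) * ((l1 + l2) * (l1 + mu * k + nu) + al * (l1 + mu * k) +
    (l2 ^+ 2 + al * l2 + rb * A * k)) by ring.
have al1 := ltW al0; have mu1 := ltW mu0; have nu1 := ltW nu0.
have rb1 := ltW rb0; have A1 := ltW A0.
by rewrite mulr_ge0// !addr_ge0// ?mulr_ge0// ?addr_ge0// ?mulr_ge0// ?exprn_ge0.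
Qed.

(* The positive zero of [dispersion 0]. *)
Let kstar : R := (be * ga - nu * A) / (A * mu).

Let kstar_gt0 : 0 < kstar. Proof. by rewrite divr_gt0 ?subr_gt0// mulr_gt0. Qed.

(** The sign at rate 0: negative strictly between 0 and [kstar], which forces the root there to be
    positive. *)
Let dispersion0E k : dispersion 0 k = rb * k * (A * mu * (k - kstar)).
Proof. by rewrite /dispersion /kstar; field; rewrite !gt_eqF. Qed.

Lemma continuous_dispersion_l k : continuous (dispersion ^~ k).
Proof.
move=> l; apply: cvgB; last exact: cvg_cst.
apply: cvgM.
  apply: cvgD; last exact: cvg_cst.
  apply: cvgD; first exact: exprn_continuous.
  by apply: cvgM; [exact: cvg_cst|exact: cvg_id].
by apply: cvgD; [apply: cvgD; [exact: cvg_id|exact: cvg_cst]|exact: cvg_cst].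
Qed.

Lemma continuous_dispersion_k l : continuous (dispersion l).
Proof.
move=> k; apply: cvgB; last by apply: cvgM; [exact: cvg_cst|exact: cvg_id].
apply: cvgM.
  by apply: cvgD; [exact: cvg_cst|apply: cvgM; [exact: cvg_cst|exact: cvg_id]].
apply: cvgD; last exact: cvg_cst.
by apply: cvgD; [exact: cvg_cst|apply: cvgM; [exact: cvg_cst|exact: cvg_id]].
Qed.

Lemma dispersion_root k : 0 <= k <= kstar -> exists l, 0 <= l /\ dispersion l k = 0.
Proof.
move=> /andP[k0 kk].
(* Since [X >= 1], the positive part of the cubic at [X] is at least [X ^+ 3 >= X], which exceeds
   the subtracted term [rb * be * ga * k]. *)
pose X := rb * be * ga * k + 1.
have X1 : 1 <= X by rewrite lerDr !mulr_ge0// ltW.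
have X0 : 0 <= X := le_trans ler01 X1.
have [| |l] := @IVT _ (dispersion ^~ k) 0 X 0 X0.
- by apply: continuous_subspaceT; exact: continuous_dispersion_l.
- rewrite ge_min le_max; apply/andP; split; apply/orP; [left|right].
    rewrite dispersion0E mulr_ge0_le0 ?mulr_ge0 ?(ltW rb0)//.
    by rewrite mulr_ge0_le0 ?subr_le0// mulr_ge0// ltW.
  rewrite /dispersion subr_ge0 (@le_trans _ _ X)//; first by rewrite /X lerDl.
  rewrite (@le_trans _ _ (X ^+ 2 * X))//.
    by rewrite ler_peMl// expr_ge1.
  have p1 : 0 <= al * X by rewrite mulr_ge0// ltW.
  have p2 : 0 <= rb * A * k by rewrite !mulr_ge0// ltW.
  have p3 : 0 <= mu * k by rewrite mulr_ge0// ltW.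
  by rewrite ler_pM ?sqr_ge0//; have := nu0; lra.
- by rewrite in_itv/= => /andP[l0 _] E; exists l.
Qed.

Lemma growth_rate : exists (L : R -> R) (Theta k0 : R),
  [/\ continuous L, 0 < Theta, 0 < k0, L k0 = Theta &
    forall k, 0 <= L k <= Theta /\ (0 <= k <= k0 -> dispersion (L k) k = 0)].
Proof.
have clampP := @clamp_itv R 0 kstar kstar_gt0.
(* Roots are chosen at clamped arguments, so that the rate is defined and continuous on the whole
   line and attains its maximum on [[0, kstar]]. *)
have /choice[L1 HL1] : forall k, exists l, 0 <= l /\ dispersion l (clamp 0 kstar k) = 0.
  by move=> k; apply: dispersion_root; exact: clampP.
pose L k := L1 (clamp 0 kstar k).
have HL k : 0 <= L k /\ dispersion (L k) (clamp 0 kstar k) = 0.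
  by rewrite /L; have := HL1 (clamp 0 kstar k); rewrite (clamp_id (clampP k)).
have cL : continuous L.
  move=> k0; apply/cvgrPdist_le => e e0.
  have q0 : dispersion (L k0) (clamp 0 kstar k) @[k --> k0] --> 0.
    suff : dispersion (L k0) (clamp 0 kstar k) @[k --> k0] -->
      dispersion (L k0) (clamp 0 kstar k0) by rewrite (HL k0).2.
    apply: (@continuous_comp _ _ _ (clamp 0 kstar) (dispersion (L k0))).
      exact: continuous_clamp.
    exact: continuous_dispersion_k.
  have an0 : 0 < al * nu by rewrite mulr_gt0.
  move/cvgr0Pnorm_le : q0 => /(_ (al * nu * e)); rewrite mulr_gt0// => /(_ isT).
  apply: filterS => k qk.
  rewrite -(ler_pM2l an0); apply: le_trans qk.
  have [Lk0 Lk] := HL k; have [Lk00 _] := HL k0.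
  have [/andP[c0 _]] := clampP k.
  have [le1|/ltW le1] := leP (L k) (L k0).
    have := dispersion_increasing c0 Lk0 le1; rewrite Lk subr0 => le2.
    by rewrite ger0_norm ?subr_ge0// (le_trans le2)// ler_norm.
  have := dispersion_increasing c0 Lk00 le1; rewrite Lk sub0r => le2.
  by rewrite ler0_norm ?subr_le0// opprB (le_trans le2)// -normrN ler_norm.
have [k0 k0I kmax] : exists2 c, c \in `[0, kstar] & forall t, t \in `[0, kstar] -> L t <= L c.
  by apply: EVT_max; [exact: ltW|exact: continuous_subspaceT].
have LE k : L k <= L k0.
  have -> : L k = L (clamp 0 kstar k) by rewrite /L (clamp_id (clampP k)).
  by apply: kmax; rewrite in_itv/=; exact: clampP.
have half0 : 0 < kstar / 2 by rewrite divr_gt0.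
have halfI : 0 <= kstar / 2 <= kstar by apply/andP; split; have := kstar_gt0; lra.
(* It is enough that the root at the midpoint [kstar / 2] is not 0, and the cubic is negative at
   rate 0 there. *)
have Theta0 : 0 < L k0.
  apply: lt_le_trans (LE (kstar / 2)); have [Lh ph] := HL (kstar / 2).
  rewrite lt_neqAle Lh andbT; apply/eqP => Lh0.
  move: ph; rewrite (clamp_id halfI) -Lh0 dispersion0E => ph.
  have : 0 < rb * (kstar / 2) * (A * mu * (kstar / 2)).
    by apply: mulr_gt0; apply: mulr_gt0 => //; apply: mulr_gt0.
  by move: ph; set z := kstar; lra.
have /andP[k00 k0k] : 0 <= k0 <= kstar by move: k0I; rewrite in_itv.
exists L, (L k0), k0; split => //; last first.
  move=> k; split; first by rewrite LE andbT; have [] := HL k.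
  move=> /andP[kge kle]; have [_] := HL k; rewrite clamp_id// kge.
  exact: le_trans k0k.
(* At [k = 0] the cubic is [(l ^+ 2 + al * l) * (l + nu)], which has no positive root, so the
   maximum is not attained there. *)
rewrite lt_neqAle k00 andbT; apply/eqP => k0E.
have [_] := HL k0; rewrite clamp_id ?k00//; move: Theta0; rewrite -k0E => L00 /eqP.
rewrite /dispersion !mulr0 subr0 !addr0 expr2 -mulrDl !mulf_eq0.
by rewrite !gt_eqF ?addr_gt0.
Qed.

End dispersion.

(** * Waves *)

Section partial_cst.
Context {R : realType}.

Lemma partialDcst (i : 'I_3) (f : R3 R -> R) (c : R) :
  partial i (fun x => f x + c) = partial i f.
Proof.
apply/funext => x; rewrite /partial /derive; set F := (X in lim (X @ _)).
set G := (X in _ = lim (X @ _)); suff -> : F = G by [].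
by apply/funext => h; rewrite /F /G /= opprD addrACA subrr addr0.
Qed.

Lemma has_partialDcst (i : 'I_3) (f : R3 R -> R) (c : R) (x : R3 R) :
  has_partial i f x -> has_partial i (fun x => f x + c) x.
Proof.
rewrite /has_partial /derivable; set F := (X in X @ _).
set G := (X in _ -> cvg (X @ _)); suff -> : F = G by [].
by apply/funext => h; rewrite /F /G /= opprD addrACA subrr addr0.
Qed.

End partial_cst.

Section waves.
Context {R : realType}.
Variables (a b : R).
Hypotheses (a0 : 0 < a) (ab : a < b).
Variable lam : R3 R -> R.
Hypothesis clam : continuous lam.
Implicit Types (m : nat -> nat) (g h : R3 R -> R) (t : R) (x : R3 R).

Definition sqnorm (xi : R3 R) : R := \sum_(i < 3) coord3 i xi ^+ 2.

Lemma continuous_sqnorm : continuous sqnorm.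
Proof.
rewrite (_ : sqnorm = fun xi => coord3 0 xi ^+ 2 + coord3 1 xi ^+ 2 + coord3 2 xi ^+ 2).
  move=> xi; have cc i : coord3 i z ^+ 2 @[z --> xi] --> coord3 i xi ^+ 2.
    exact: (cvgM (@continuous_coord3 R i xi) (@continuous_coord3 R i xi)).
  by apply: cvgD; [apply: cvgD|]; exact: cc.
by apply/funext => xi; rewrite /sqnorm !big_ord_recr big_ord0 /= add0r.
Qed.

Definition wave m g t : R3 R -> R :=
  synthesis a b m (fun xi => g xi * expR (t * lam xi)).

Lemma continuous_wave g t : continuous g ->
  continuous (fun xi => g xi * expR (t * lam xi)).
Proof.
move=> cg xi; apply: cvgM; first exact: cg.
apply: (@continuous_comp _ _ _ (fun xi => t * lam xi) expR); last exact: continuous_expR.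
by apply: cvgM; [exact: cvg_cst|exact: clam].
Qed.

Lemma continuous_coord3M (i : nat) g : continuous g ->
  continuous (fun xi => coord3 i xi * g xi).
Proof. by move=> cg xi; apply: cvgM; [exact: continuous_coord3|exact: cg]. Qed.

Lemma wave_eq0 m g t x : (forall xi, box a b xi -> g xi = 0) -> wave m g t x = 0.
Proof.
move=> g0; rewrite -[RHS](synthesis0 a b m x) /wave; congr (_ x); apply: eq_synthesis => xi xib.
by rewrite g0// mul0r.
Qed.

Lemma waveZ m g c t x : continuous g ->
  wave m (fun xi => c * g xi) t x = c * wave m g t x.
Proof.
move=> cg; rewrite /wave -synthesisZ//; last exact: continuous_wave.
by congr (synthesis _ _ _ _ _); apply/funext => xi; rewrite mulrA.
Qed.

Lemma waveD m g h t x : continuous g -> continuous h ->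
  wave m (fun xi => g xi + h xi) t x = wave m g t x + wave m h t x.
Proof.
move=> cg ch; rewrite /wave -synthesisD//; [|exact: continuous_wave|exact: continuous_wave].
by congr (synthesis _ _ _ _ _); apply/funext => xi; rewrite mulrDl.
Qed.

Lemma is_derive_wave m g x t : continuous g ->
  is_derive t (1 : R) (fun t => wave m g t x) (wave m (fun xi => lam xi * g xi) t x).
Proof.
move=> cg; have := is_derive_synthesis_time ab m x t cg clam.
rewrite /wave; congr (is_derive _ _ _ (synthesis _ _ _ _ _)).
by apply/funext => xi; rewrite mulrA.
Qed.

Lemma has_partial_wave (i : 'I_3) m g t x : continuous g ->
  has_partial i (wave m g t) x.
Proof. by move=> cg; apply: has_partial_synthesis => //; exact: continuous_wave. Qed.

Lemma partial_wave (i : 'I_3) m g t : continuous g ->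
  partial i (wave m g t) = wave (phase_shift i m) (fun xi => coord3 i xi * g xi) t.
Proof.
move=> cg; rewrite partial_synthesis//; last exact: continuous_wave.
by rewrite /wave; congr synthesis; apply/funext => xi; rewrite mulrA.
Qed.

Lemma partial_phase_shift_wave (i : 'I_3) m g t x : continuous g ->
  partial i (wave (phase_shift i m) (fun xi => coord3 i xi * g xi) t) x =
  - wave m (fun xi => coord3 i xi ^+ 2 * g xi) t x.
Proof.
move=> cg; rewrite partial_wave; last exact: continuous_coord3M.
rewrite /wave synthesisSS//; last first.
  by apply: continuous_wave; do 2! apply: continuous_coord3M.
by congr (- synthesis _ _ _ _ _); apply/funext => xi; rewrite expr2 !mulrA.
Qed.

(** Used twice: as the divergence of a velocity that is the gradient of a wave, and as the Laplacian
    of that wave. *)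
Lemma sum_partial_phase_shift_wave m g t x : continuous g ->
  \sum_(i < 3) partial i (wave (phase_shift i m) (fun xi => coord3 i xi * g xi) t) x =
  - wave m (fun xi => sqnorm xi * g xi) t x.
Proof.
move=> cg; under eq_bigr do rewrite partial_phase_shift_wave//.
have c2 (i : nat) : continuous (fun xi => coord3 i xi ^+ 2 * g xi).
  move=> xi; apply: cvgM; last exact: cg.
  exact: (cvgM (@continuous_coord3 R i xi) (@continuous_coord3 R i xi)).
have c01 : continuous (fun xi => coord3 0 xi ^+ 2 * g xi + coord3 1 xi ^+ 2 * g xi).
  by move=> xi; exact: (cvgD (@c2 0%N xi) (@c2 1%N xi)).
rewrite sumrN !big_ord_recr big_ord0 /= add0r.
rewrite -(waveD m t x (c2 0%N) (c2 1%N)) -(waveD m t x c01 (c2 2%N)).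
congr (- wave _ _ _ _); apply/funext => xi.
by rewrite /sqnorm !big_ord_recr big_ord0 /= add0r !mulrDl.
Qed.

Lemma laplacian_wave m g t x : continuous g ->
  laplacian (wave m g t) x = - wave m (fun xi => sqnorm xi * g xi) t x.
Proof.
move=> cg; rewrite -sum_partial_phase_shift_wave//; apply: eq_bigr => i _.
by rewrite partial_wave.
Qed.

Lemma continuous_into_H_wave k m g : continuous g -> continuous_into_H k (wave m g).
Proof. by move=> cg; exact: continuous_into_H_synthesis. Qed.

(** The squared L^2 norm of a wave read on the frequency side. It does not involve the phase [m], so
    shifted components are measured in the same way. *)
Definition energy g t : R :=
  pi ^+ 3 * \int[lebesgue3 R]_(xi in box a b) (g xi * expR (t * lam xi)) ^+ 2.

Lemma energy_ge0 g t : 0 <= energy g t.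
Proof.
rewrite mulr_ge0 ?exprn_ge0 ?pi_ge0//.
by apply: Rintegral_ge0 => xi _; exact: sqr_ge0.
Qed.

Lemma L2norm_wave m g t : continuous g ->
  L2norm (wave m g t) = (Num.sqrt (energy g t))%:E.
Proof. by move=> cg; rewrite L2norm_synthesis//; exact: continuous_wave. Qed.

Lemma L2normv_wave (m : 'I_3 -> nat -> nat) (g : 'I_3 -> R3 R -> R) t :
  (forall i, continuous (g i)) ->
  L2normv (fun x => \row_i wave (m i) (g i) t x) =
  (Num.sqrt (\sum_(i < 3) energy (g i) t))%:E.
Proof.
move=> cg; apply: L2norm_sqrt.
  by apply: sumr_ge0 => i _; exact: energy_ge0.
transitivity (\int[lebesgue3 R]_x \sum_(i < 3) (wave (m i) (g i) t x ^+ 2)%:E)%E.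
  apply: eq_integral => x _; rewrite /= /euclid sqr_sqrtr; last first.
    by apply: sumr_ge0 => i _; exact: sqr_ge0.
  by rewrite sumEFin; congr (_%:E); apply: eq_bigr => i _; rewrite mxE.
rewrite ge0_integral_sum//.
- rewrite -sumEFin; apply: eq_bigr => i _; rewrite plancherel_synthesis//.
  exact: continuous_wave.
- move=> i; apply/measurable_EFinP; apply: measurable_funX.
  by apply: measurable_synthesis => //; exact: continuous_wave.
- by move=> i x _; rewrite lee_fin sqr_ge0.
Qed.

Lemma energy_growth g t (lo hi : R) : continuous g -> 0 <= t ->
  (forall xi, box a b xi -> lo <= lam xi <= hi) ->
  expR (lo * t) ^+ 2 * energy g 0 <= energy g t <= expR (hi * t) ^+ 2 * energy g 0.
Proof.
move=> cg t0 lohi; rewrite /energy ![_ ^+ 2 * (_ * _)]mulrCA.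
have c2 s : continuous (fun xi => (g xi * expR (s * lam xi)) ^+ 2).
  by move=> xi; exact: (cvgM (@continuous_wave g s cg xi) (@continuous_wave g s cg xi)).
have ii s := integrable_box ab (c2 s).
have iZ s c : (lebesgue3 R).-integrable (box a b)
    (EFin \o (fun xi => c * (g xi * expR (s * lam xi)) ^+ 2)).
  apply: integrable_box => // xi.
  by apply: cvgM; [exact: cvg_cst|exact: c2].
rewrite !ler_pM2l ?exprn_gt0 ?pi_gt0//.
rewrite -!RintegralZl//; [|exact: measurable_box|exact: measurable_box].
have expR2 (r s : R) : r <= s -> expR (r * t) ^+ 2 <= expR (s * t) ^+ 2.
  by move=> rs; rewrite lerXn2r ?nnegrE ?expR_ge0// ler_expR ler_wpM2r.
apply/andP; split; (apply: le_Rintegral => //; first exact: measurable_box) => xi xib;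
  have /andP[l1 l2] := lohi xi xib; rewrite mul0r expR0 mulr1 exprMn [t * _]mulrC.
- by rewrite [leLHS]mulrC ler_wpM2l ?sqr_ge0// expR2.
- by rewrite [leRHS]mulrC ler_wpM2l ?sqr_ge0// expR2.
Qed.

Lemma energy_gt0 g (c : R) : continuous g -> 0 < c ->
  (forall xi, box a b xi -> c <= g xi) -> 0 < energy g 0.
Proof.
move=> cg c0 gc; rewrite mulr_gt0 ?exprn_gt0 ?pi_gt0//.
apply: (@lt_le_trans _ _ (\int[lebesgue3 R]_(xi in box a b) c ^+ 2)).
  rewrite Rintegral_cst//; last exact: measurable_box.
  by rewrite lebesgue3_boxE//= mulr_gt0 ?exprn_gt0 ?subr_gt0.
apply: le_Rintegral.
- exact: measurable_box.
- by apply: integrable_box => // xi; exact: cvg_cst.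
- apply: integrable_box => // xi.
  exact: (cvgM (@continuous_wave g 0 cg xi) (@continuous_wave g 0 cg xi)).
- move=> xi xib; rewrite mul0r expR0 mulr1 lerXn2r ?nnegrE ?gc//; first exact: ltW.
  exact: le_trans (ltW c0) (gc _ xib).
Qed.

End waves.

(** * Assembly of the unstable solution *)

Lemma sqrt_growth (R : realType) (X0 Xt : \bar R) (E0 Et lo hi : R) :
  X0 = (Num.sqrt E0)%:E -> Xt = (Num.sqrt Et)%:E -> 0 <= lo -> 0 <= hi ->
  lo ^+ 2 * E0 <= Et <= hi ^+ 2 * E0 -> (lo%:E * X0 <= Xt <= hi%:E * X0)%E.
Proof.
move=> -> -> lo0 hi0 /andP[l1 l2]; rewrite -!EFinM !lee_fin.
rewrite -{1}(ger0_norm lo0) -(ger0_norm hi0) -!sqrtr_sqr -!sqrtrM ?sqr_ge0//.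
by rewrite !ler_wsqrtr.
Qed.

Theorem theorem1p1 (R : realType) (alpha beta mu nu gamma rhobar : R)
    (P : R -> R)
    (alpha_gt0 : 0 < alpha) (beta_gt0 : 0 < beta) (mu_gt0 : 0 < mu)
    (nu_gt0 : 0 < nu) (gamma_gt0 : 0 < gamma) (rhobar_gt0 : 0 < rhobar)
    (P_smooth : forall (n : nat) (r : R), 0 < r -> derivable (derive1n n P) r 1)
    (P_incr : forall r : R, 0 < r -> 0 < derive1 P r)
    (unstable : nu * derive1 P rhobar / (gamma * rhobar) < beta) :
  exists Theta : R, 0 < Theta /\
  forall Thetabar : R, 0 < Thetabar -> Thetabar <= Theta / 2 ->
  exists (rho0 : R3 R -> R) (u0 : R3 R -> 'rV[R]_3) (phi0 : R3 R -> R)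
         (rho : R -> R3 R -> R) (u : R -> R3 R -> 'rV[R]_3)
         (phi : R -> R3 R -> R),
  [/\ linear_system alpha beta mu nu gamma rhobar P rho u phi,
      [/\ rho 0 = rho0, u 0 = u0 & phi 0 = phi0],
      [/\ continuous_into_H 3 (fun t x => rho t x - rhobar),
          forall i : 'I_3, continuous_into_H 3 (fun t => vcomp (u t) i) &
          continuous_into_H 3 (fun t x => phi t x - gamma / nu * rhobar)],
      (forall t : R, 0 <= t ->
        [/\ ((expR ((Theta - Thetabar) * t))%:E
               * L2norm (fun x => (rho0 x - rhobar)%R)
             <= L2norm (fun x => (rho t x - rhobar)%R)
             <= (expR (Theta * t))%:E
               * L2norm (fun x => (rho0 x - rhobar)%R))%E,
            ((expR ((Theta - Thetabar) * t))%:E * L2normv u0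
             <= L2normv (u t)
             <= (expR (Theta * t))%:E * L2normv u0)%E &
            ((expR ((Theta - Thetabar) * t))%:E
               * L2norm (fun x => (phi0 x - gamma / nu * rhobar)%R)
             <= L2norm (fun x => (phi t x - gamma / nu * rhobar)%R)
             <= (expR (Theta * t))%:E
               * L2norm (fun x => (phi0 x - gamma / nu * rhobar)%R))%E]) &
      (0 < L2norm (fun x => (rho0 x - rhobar)%R) * L2normv u0
           * L2norm (fun x => (phi0 x - gamma / nu * rhobar)%R))%E].
Proof.
set A := derive1 P rhobar / rhobar.
have A0 : 0 < A by rewrite divr_gt0// P_incr.
have unst : nu * A < beta * gamma.
  move: unstable; rewrite ltr_pdivrMr ?mulr_gt0// => un.
  by rewrite /A mulrA ltr_pdivrMr// -mulrA.
have [rate [ Theta [k0 [crate Theta0 k00 rate_k0 rateP]]]] :=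
  growth_rate alpha_gt0 beta_gt0 mu_gt0 nu_gt0 gamma_gt0 rhobar_gt0 A0 unst.
exists Theta; split => // Tb Tb0 TbT.
(* A positive lower rate keeps [lam] positive on the cube, hence the velocity amplitude away from
   0. *)
have rate0 : 0 < Theta - Tb by lra.
have [d d0 rate_d] : exists2 d, 0 < d & forall k, `|k0 - k| < d -> Theta - Tb <= rate k.
  have /cvgrPdist_lt/(_ _ Tb0)[d /= d0 Hd] : rate k @[k --> k0] --> rate k0 by exact: crate.
  exists d => // k kd; have := Hd k kd; rewrite rate_k0 => /(le_lt_trans (ler_norm _)).
  by lra.
(* The first entry keeps [[k1, k0]] within [d] of [k0], the second keeps [k1] positive. *)
pose k1 := Num.max (k0 - d / 2) (k0 / 2).
have k10 : 0 < k1 by rewrite lt_max divr_gt0 ?orbT.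
have k1k0 : k1 < k0 by rewrite gt_max; apply/andP; split; lra.
(* Each of the three squared coordinates lies in [[k1 / 3, k0 / 3]], so their sum lies in
   [[k1, k0]]. *)
pose a := Num.sqrt (k1 / 3); pose b := Num.sqrt (k0 / 3).
have a0 : 0 < a by rewrite sqrtr_gt0 divr_gt0.
have ab : a < b by rewrite ltr_sqrt ?divr_gt0// ltr_pM2r.
have a2 : a ^+ 2 = k1 / 3 by rewrite sqr_sqrtr// divr_ge0// ltW.
have b2 : b ^+ 2 = k0 / 3 by rewrite sqr_sqrtr// divr_ge0// ltW.
have sq_box xi : box a b xi -> k1 <= sqnorm xi <= k0.
  move=> /boxP xib; rewrite /sqnorm !big_ord_recr big_ord0 /= add0r.
  have c2 i : k1 / 3 <= coord3 i xi ^+ 2 <= k0 / 3.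
    have /andP[l1 l2] := xib i; rewrite -a2 -b2 !lerXn2r ?nnegrE//; lra.
  by have /andP[? ?] := c2 0%N; have /andP[? ?] := c2 1%N; have /andP[? ?] := c2 2%N;
    apply/andP; split; rewrite /coord3 in c2 *; lra.
pose lam (xi : R3 R) := rate (sqnorm xi).
have clam : continuous lam.
  move=> xi; apply: (@continuous_comp _ _ _ sqnorm rate); last exact: crate.
  exact: continuous_sqnorm.
have lam_box xi : box a b xi -> Theta - Tb <= lam xi <= Theta.
  move=> /sq_box/andP[l1 l2]; have [/andP[_ ->] _] := rateP (sqnorm xi); rewrite andbT.
  apply: rate_d; rewrite ger0_norm ?subr_ge0//.
  have : k0 - d / 2 <= k1 by rewrite le_max lexx.
  by lra.
pose D xi := lam xi + mu * sqnorm xi + nu.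
have cs := @continuous_sqnorm R.
have cD : continuous D.
  move=> xi; apply: cvgD; last exact: cvg_cst.
  apply: cvgD; first exact: clam.
  by apply: cvgM; [exact: cvg_cst|exact: cs].
(* The amplitudes of the density, the velocity potential and the potential
   [phi] in the eigenvector of rate [lam xi], multiplied by
   [rhobar * sqnorm xi * D xi] to clear denominators. *)
pose gn xi := rhobar * sqnorm xi * D xi.
pose gu xi := lam xi * D xi.
pose gp xi := gamma * rhobar * sqnorm xi.
have cgp : continuous gp.
  by move=> xi; apply: cvgM; [exact: cvg_cst|exact: cs].
have cgu : continuous gu.
  by move=> xi; apply: cvgM; [exact: clam|exact: cD].
have cgn : continuous gn.
  move=> xi; apply: cvgM; last exact: cD.
  by apply: cvgM; [exact: cvg_cst|exact: cs].
(* The momentum equation on the frequency side, and the only one that uses the cubic; the other two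
   equations hold identically for these amplitudes. *)
have disp xi : box a b xi -> (lam xi + alpha) * gu xi + A * gn xi - beta * gp xi = 0.
  move=> xib; have /andP[l1 l2] := sq_box _ xib.
  have [_] := rateP (sqnorm xi); rewrite l2 (le_trans (ltW k10) l1) => /(_ isT).
  by rewrite /dispersion -/(lam xi) /gu /gn /gp /D => <-; ring.
pose m0 (j : nat) := 0%N.
pose c := gamma / nu * rhobar.
pose n := wave a b lam m0 gn.
(* By [partial_wave] this is the gradient of the potential [wave a b lam m0 gu]. *)
pose v (i : 'I_3) := wave a b lam (phase_shift i m0) (fun xi => coord3 i xi * gu xi).
pose p := wave a b lam m0 gp.
pose rho t x := n t x + rhobar.
pose u t x : 'rV[R]_3 := \row_i v i t x.
pose phi t x := p t x + c.
have cgc (i : 'I_3) : continuous (fun xi => coord3 i xi * gu xi) by exact: continuous_coord3M.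
have rhoE t : (fun x => rho t x - rhobar) = n t.
  by apply/funext => x; rewrite /rho addrK.
have phiE t : (fun x => phi t x - gamma / nu * rhobar) = p t.
  by apply/funext => x; rewrite /phi /c addrK.
have uE t i : vcomp (u t) i = v i t by apply/funext => x; rewrite /vcomp mxE.
have Ln t : L2norm (fun x => rho t x - rhobar) = (Num.sqrt (energy a b lam gn t))%:E.
  by rewrite rhoE; exact: L2norm_wave.
have Lp t : L2norm (fun x => phi t x - gamma / nu * rhobar) =
    (Num.sqrt (energy a b lam gp t))%:E.
  by rewrite phiE; exact: L2norm_wave.
have Lu t : L2normv (u t) =
    (Num.sqrt (\sum_(i < 3) energy a b lam (fun xi => coord3 i xi * gu xi) t))%:E.
  exact: L2normv_wave.
exists (rho 0), (u 0), (phi 0), rho, u, phi; split => //.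
- move=> t x _.
  have d_rho : is_derive t (1 : R) (rho ^~ x) (wave a b lam m0 (fun xi => lam xi * gn xi) t x).
    have dn := is_derive_wave ab clam m0 x t cgn.
    by apply: is_derive_eq; rewrite addr0.
  have d_phi : is_derive t (1 : R) (phi ^~ x) (wave a b lam m0 (fun xi => lam xi * gp xi) t x).
    have dp := is_derive_wave ab clam m0 x t cgp.
    by apply: is_derive_eq; rewrite addr0.
  have d_u (i : 'I_3) : is_derive t (1 : R) (fun s => u s x ord0 i)
      (wave a b lam (phase_shift i m0) (fun xi => lam xi * (coord3 i xi * gu xi)) t x).
    rewrite (_ : (fun s => _) = fun s => v i s x); last by apply/funext => s; rewrite mxE.
    exact: is_derive_wave.
  have rho_x i : partial i (rho t) = wave a b lam (phase_shift i m0) (fun xi => coord3 i xi * gn xi) t.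
    by rewrite /rho partialDcst partial_wave.
  have phi_x i : partial i (phi t) = wave a b lam (phase_shift i m0) (fun xi => coord3 i xi * gp xi) t.
    by rewrite /phi partialDcst partial_wave.
  split.
  + split; first by have [] := d_rho.
      by move=> i; have [] := d_u i.
    by have [] := d_phi.
  + move=> i; split.
    * by apply: has_partialDcst; exact: has_partial_wave.
    * by move=> j; rewrite uE; exact: has_partial_wave.
    * by apply: has_partialDcst; exact: has_partial_wave.
    * by rewrite phi_x; apply: has_partial_wave => //; exact: continuous_coord3M.
  + rewrite derive1E; have [_ ->] := d_rho.
    rewrite /divergence; under eq_bigr do rewrite uE.
    rewrite sum_partial_phase_shift_wave// mulrN -waveZ//; last first.
      by move=> xi; apply: cvgM; [exact: cs|exact: cgu].
    apply/eqP; rewrite subr_eq0; apply/eqP; congr (wave _ _ _ _ _ _ _).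
    by apply/funext => xi; rewrite /gn /gu; ring.
  + apply/rowP => i; rewrite !mxE derive1E; have [_ ->] := d_u i.
    rewrite rho_x phi_x /v.
    have ccM (k : R) g : continuous g -> continuous (fun xi => k * (coord3 i xi * g xi)).
      by move=> cg xi; apply: cvgM; [exact: cvg_cst|exact: continuous_coord3M].
    have cl : continuous (fun xi => lam xi * (coord3 i xi * gu xi)).
      by move=> xi; apply: cvgM; [exact: clam|exact: cgc].
    have c1 : continuous (fun xi => lam xi * (coord3 i xi * gu xi) + A * (coord3 i xi * gn xi)).
      by move=> xi; apply: cvgD; [exact: cl|exact: ccM].
    have c2 : continuous (fun xi => lam xi * (coord3 i xi * gu xi) + A * (coord3 i xi * gn xi)
        + alpha * (coord3 i xi * gu xi)).
      by move=> xi; apply: cvgD; [exact: c1|exact: ccM].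
    rewrite -mulNr -!waveZ//; try exact: continuous_coord3M.
    rewrite -(waveD ab clam _ _ _ cl (ccM A _ cgn)) -(waveD ab clam _ _ _ c1 (ccM alpha _ cgu)).
    rewrite -(waveD ab clam _ _ _ c2 (ccM (- beta) _ cgp)).
    apply: wave_eq0 => xi xib; rewrite -[RHS](mulr0 (coord3 i xi)) -(disp _ xib).
    by ring.
  + rewrite derive1E; have [_ ->] := d_phi.
    have -> : laplacian (phi t) x = laplacian (p t) x.
      by apply: eq_bigr => i _; rewrite /phi partialDcst.
    rewrite laplacian_wave// /phi /rho.
    (* The constant state balances the potential equation, so only the perturbations remain. *)
    have nuc : nu * c = gamma * rhobar by rewrite /c; field; rewrite gt_eqF.
    have cM (k : R) (g : R3 R -> R) : continuous g -> continuous (fun xi => k * g xi).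
      by move=> cg xi; apply: cvgM; [exact: cvg_cst|exact: cg].
    have cl : continuous (fun xi => lam xi * gp xi).
      by move=> xi; apply: cvgM; [exact: clam|exact: cgp].
    have csg : continuous (fun xi => sqnorm xi * gp xi).
      by move=> xi; apply: cvgM; [exact: cs|exact: cgp].
    have c1 : continuous (fun xi => lam xi * gp xi + mu * (sqnorm xi * gp xi)).
      by move=> xi; apply: cvgD; [exact: cl|exact: cM].
    have c2 : continuous (fun xi => lam xi * gp xi + mu * (sqnorm xi * gp xi) + nu * gp xi).
      by move=> xi; apply: cvgD; [exact: c1|exact: cM].
    have : wave a b lam m0 (fun xi => lam xi * gp xi) t x +
        mu * wave a b lam m0 (fun xi => sqnorm xi * gp xi) t x +
        nu * p t x + - gamma * n t x = 0.
      rewrite /p /n -!waveZ//.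
      rewrite -(waveD ab clam _ _ _ cl (cM mu _ csg)) -(waveD ab clam _ _ _ c1 (cM nu _ cgp)).
      rewrite -(waveD ab clam _ _ _ c2 (cM (- gamma) _ cgn)).
      by apply: wave_eq0 => xi _; rewrite /gp /gn /D; ring.
    by rewrite !mulrDr -nuc; lra.
- split.
  + under eq_fun do rewrite rhoE.
    exact: continuous_into_H_wave.
  + move=> i; under eq_fun do rewrite uE.
    exact: continuous_into_H_wave.
  + under eq_fun do rewrite phiE.
    exact: continuous_into_H_wave.
- move=> t t0; split.
  + apply: (sqrt_growth (Ln 0) (Ln t) (expR_ge0 _) (expR_ge0 _)).
    exact: energy_growth.
  + apply: (sqrt_growth (Lu 0) (Lu t) (expR_ge0 _) (expR_ge0 _)).
    rewrite !mulr_sumr; apply/andP; split; apply: ler_sum => i _;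
      by have /andP[] := energy_growth ab clam (cgc i) t0 lam_box.
  + apply: (sqrt_growth (Lp 0) (Lp t) (expR_ge0 _) (expR_ge0 _)).
    exact: energy_growth.
- rewrite (Ln 0) (Lu 0) (Lp 0) -!EFinM lte_fin.
  have D_box xi : box a b xi -> nu <= D xi.
    move=> xib; have /andP[l1 _] := lam_box _ xib; have /andP[s1 _] := sq_box _ xib.
    by rewrite lerDr addr_ge0 ?mulr_ge0 ?(ltW mu_gt0)//; lra.
  rewrite !mulr_gt0 ?sqrtr_gt0//.
  + apply: (energy_gt0 ab clam (c := rhobar * k1 * nu)) => //; first by rewrite !mulr_gt0.
    move=> xi xib; have /andP[s1 _] := sq_box _ xib.
    rewrite /gn ler_pM ?D_box//; [by rewrite !mulr_ge0// ltW|exact: ltW|].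
    by rewrite ler_wpM2l// ltW.
  (* One component is enough. The first has amplitude at least [a * ((Theta - Tb) * nu)], because
     [coord3 0 xi >= a] on the cube. *)
  + rewrite big_ord_recl ltr_wpDr//; first by apply: sumr_ge0 => i _; exact: energy_ge0.
    apply: (energy_gt0 ab clam (c := a * ((Theta - Tb) * nu))) => //.
      by rewrite !mulr_gt0.
    move=> xi xib; have /andP[l1 _] := lam_box _ xib.
    have /boxP/(_ 0%N)/andP[x1 _] := xib.
    rewrite ler_pM// ?(ltW a0)//; first by rewrite mulr_ge0// ltW.
    by rewrite ler_pM ?D_box// ltW.
  + apply: (energy_gt0 ab clam (c := gamma * rhobar * k1)) => //; first by rewrite !mulr_gt0.
    move=> xi xib; have /andP[s1 _] := sq_box _ xib.
    by rewrite /gp ler_wpM2l// mulr_ge0// ltW.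
Qed.
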